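(* Let $n\ge1$, let $A=(A_1,\dots,A_n)\in\mathbb{R}^n$ be a nonnegative vector, and let $D=n+A_1+\cdots+A_n$. For any $f\in H^1_0(\mathbb{R}^n_A,x^A\,dx)\cap L^1(\mathbb{R}^n_A,x^A\,dx)$, $$\left(\int_{\mathbb{R}^n_A}|f|^2x^A\,dx\right)^{1+\frac2D}\le\frac{2}{\Pi(A)\,e\,D}\left(\int_{\mathbb{R}^n_A}|\nabla f|^2x^A\,dx\right)\left(\int_{\mathbb{R}^n_A}|f|\,x^A\,dx\right)^{\frac4D},$$ where $\Pi(A)=\left[2^{-k}\prod_{i=1}^n\Gamma\left(\frac{A_i+1}{2}\right)\right]^{2/D}$ and $k=\sharp\{i:A_i>0\}$.
   Context: Notation: $\mathbb{R}^n_A=\{x\in\mathbb{R}^n: x_i>0\text{ if }A_i>0\}$; $x^A=|x_1|^{A_1}\cdots|x_n|^{A_n}$; $\Gamma$ is the Gamma function. $H^1_0(\mathbb{R}^n_A,x^A\,dx)$ is the closure of $C_c^1(\mathbb{R}^n)$ (functions restricted to $\mathbb{R}^n_A$; they need not vanish on the boundary of $\mathbb{R}^n_A$) with respect to the norm $\left(\int_{\mathbb{R}^n_A}(|f|^2+|\nabla f|^2)\,x^A\,dx\right)^{1/2}$. *)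

(* Defs.v *)
From HB Require Import structures.
From mathcomp Require Import all_boot all_order all_algebra.
From mathcomp Require Import all_classical all_reals all_analysis.

Set Implicit Arguments.
Unset Strict Implicit.
Unset Printing Implicit Defensive.

Import Order.TTheory GRing.Theory Num.Theory.
Import numFieldNormedType.Exports.

Local Open Scope classical_set_scope.
Local Open Scope ring_scope.

(* The sigma-algebra on R^n generated by the coordinates, i.e. the Borel one,
   as [measurable_structure] does for [n.-tuple T]. *)
Definition measure_rV_display : measure_display.
Proof. exact: default_measure_display. Qed.

Section measurable_rV.
Context (R : realType) (n : nat).

Let coor (i : 'I_n) (x : 'rV[R]_n) : measurableTypeR R := x ord0 i.

Let rV_set0 : g_sigma_preimage coor set0.
Proof. exact: sigma_algebra0. Qed.

Let rV_setC B : g_sigma_preimage coor B -> g_sigma_preimage coor (~` B).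
Proof. exact: sigma_algebraC. Qed.

Let rV_bigcup (F : (set 'rV[R]_n)^nat) :
  (forall i, g_sigma_preimage coor (F i)) ->
  g_sigma_preimage coor (\bigcup_i (F i)).
Proof. exact: sigma_algebra_bigcup. Qed.

HB.instance Definition _ := @isMeasurable.Build measure_rV_display
  'rV[R]_n (g_sigma_preimage coor) rV_set0 rV_setC rV_bigcup.

End measurable_rV.

Section rV_cons.
Context (R : realType).

Definition rV_cons n (p : measurableTypeR R * 'rV[R]_n) : 'rV[R]_n.+1 :=
  \row_i (if unlift ord0 i is Some j then p.2 ord0 j else p.1).

Definition rV_uncons n (x : 'rV[R]_n.+1) : measurableTypeR R * 'rV[R]_n :=
  (x ord0 ord0, \row_j x ord0 (lift ord0 j)).

Lemma rV_consK n : cancel (@rV_cons n) (@rV_uncons n).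
Proof.
move=> [t x]; rewrite /rV_uncons !mxE unlift_none; congr pair.
by apply/rowP => j; rewrite !mxE liftK.
Qed.

Lemma rV_unconsK n : cancel (@rV_uncons n) (@rV_cons n).
Proof.
move=> x; apply/rowP => i; rewrite !mxE /=.
by case: unliftP => [j|] ->//; rewrite mxE.
Qed.

Lemma measurable_coor n (i : 'I_n) :
  measurable_fun [set: 'rV[R]_n] (fun x => x ord0 i : measurableTypeR R).
Proof.
move=> _ Y mY; rewrite setTI; apply: sub_sigma_algebra => /=.
rewrite -bigcup_seq/=; exists i => /=; first by rewrite mem_index_enum.
by exists Y => //; rewrite setTI.
Qed.

Lemma measurable_fun_rVP d (T : measurableType d) n (f : T -> 'rV[R]_n) :
  (forall i, measurable_fun [set: T] (fun t => f t ord0 i : measurableTypeR R)) ->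
  measurable_fun [set: T] f.
Proof.
move=> mf _ A mA; rewrite setTI.
move: mA; rewrite /measurable/= => /(_ [set B | measurable (f @^-1` B)]); apply.
split; first split => [|B|F].
- by rewrite /= preimage_set0.
- by move=> mB; rewrite /= setTD preimage_setC; exact: measurableC.
- by move=> mF; rewrite /= preimage_bigcup; apply: bigcup_measurable => k _; exact: mF.
- rewrite -bigcup_seq => B [i _ [C mC <-]] /=.
  by rewrite setTI; have := mf i measurableT C mC; rewrite setTI.
Qed.

Lemma measurable_rV_cons n : measurable_fun setT (@rV_cons n).
Proof.
apply: measurable_fun_rVP => i; under eq_fun do rewrite mxE.
case: unliftP => [j _|_]; last exact: measurable_fst.
exact: (measurableT_comp (measurable_coor j) measurable_snd).
Qed.

Lemma measurable_rV_uncons n : measurable_fun setT (@rV_uncons n).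
Proof.
apply: measurable_fun_pair; first exact: measurable_coor.
by apply: measurable_fun_rVP => j; under eq_fun do rewrite mxE;
  exact: measurable_coor.
Qed.

End rV_cons.

Section lebesgue_rV.
Context (R : realType).
Local Open Scope ereal_scope.

(* Lebesgue measure on the Borel sets of R^n, as the n-fold product of the
   one-dimensional one. *)
Fixpoint lebesgue_rV (n : nat) : set 'rV[R]_n -> \bar R :=
  match n return set 'rV[R]_n -> \bar R with
  | 0 => dirac (0%R : 'rV[R]_0)
  | m.+1 => pushforward (lebesgue_measure \x @lebesgue_rV m) (@rV_cons R m)
  end.
Arguments lebesgue_rV n _ : clear implicits.

Lemma lebesgue_rV_sigma_finite_measure n :
  {m : {sigma_finite_measure set 'rV[R]_n -> \bar R} | lebesgue_rV n = m}.
Proof.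
elim: n => [|n [m /= mE]].
  by exists (dirac (0 : 'rV[R]_0)%R).
rewrite /= mE.
have [q qE] : {q : {measure set 'rV[R]_n.+1 -> \bar R} |
    pushforward (lebesgue_measure \x m) (@rV_cons R n) = q}.
  by exists (measure_function_pushforward__canonical__measure_function_Measure
    (lebesgue_measure \x m) (@measurable_rV_cons R n)).
have q_sigma_finite : sigma_finite setT q.
  have /sigma_finiteP[F [TF ndF Foo]] := sigma_finiteT (@lebesgue_measure R).
  have /sigma_finiteP[G [TG ndG Goo]] := sigma_finiteT m.
  exists (fun k => @rV_uncons R n @^-1` (F k `*` G k)).
    rewrite -preimage_bigcup (_ : \bigcup_k _ = setT) ?preimage_setT//.
    apply/seteqP; split=> // -[x y] _.
    have [k _ Fkx] : (\bigcup_k F k) x by rewrite -TF.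
    have [l _ Gly] : (\bigcup_k G k) y by rewrite -TG.
    exists (maxn k l) => //; split => /=.
      by move: x Fkx; exact/subsetPset/ndF/leq_maxl.
    by move: y Gly; exact/subsetPset/ndG/leq_maxr.
  move=> k; have [mF Fk] := Foo k; have [mG Gk] := Goo k.
  split.
    rewrite -[X in measurable X]setTI.
    by apply: measurable_rV_uncons => //; exact: measurableX.
  rewrite -qE /pushforward -comp_preimage.
  rewrite (_ : _ \o _ = id) ?preimage_id; last exact/funext/rV_consK.
  by rewrite product_measure1E// lte_mul_pinfty// ge0_fin_numE.
pose sf := @isSFinite.Build _ _ _ (Measure.sort q)
  (sfinite_measure_sigma_finite q_sigma_finite).
pose sq := @isSigmaFinite.Build _ _ _ (Measure.sort q) q_sigma_finite.
by exists (HB.pack_for {sigma_finite_measure set 'rV[R]_n.+1 -> \bar R}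
  (Measure.sort q) sf sq).
Qed.

Let lebesgue_rV0 n : lebesgue_rV n set0 = 0.
Proof.
by have [m ->] := lebesgue_rV_sigma_finite_measure n; rewrite measure0.
Qed.

Let lebesgue_rV_ge0 n A : 0 <= lebesgue_rV n A.
Proof. by have [m ->] := lebesgue_rV_sigma_finite_measure n. Qed.

Let lebesgue_rV_sigma_additive n : semi_sigma_additive (lebesgue_rV n).
Proof.
have [m ->] := lebesgue_rV_sigma_finite_measure n.
exact: (@measure_semi_sigma_additive _ _ _ m).
Qed.

HB.instance Definition _ n := isMeasure.Build _ _ _ (lebesgue_rV n)
  (@lebesgue_rV0 n) (@lebesgue_rV_ge0 n) (@lebesgue_rV_sigma_additive n).

Let lebesgue_rV_sigma_finite n : sigma_finite setT (lebesgue_rV n).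
Proof.
have [m ->] := lebesgue_rV_sigma_finite_measure n; exact: (sigma_finiteT m).
Qed.

HB.instance Definition _ n := Measure_isSigmaFinite.Build _ _ _
  (lebesgue_rV n) (@lebesgue_rV_sigma_finite n).

Lemma lebesgue_rV_box n (B : 'I_n -> set (measurableTypeR R)) :
  (forall i, measurable (B i)) ->
  lebesgue_rV n [set x | forall i, B i (x ord0 i)] =
  \prod_(i < n) lebesgue_measure (B i).
Proof.
elim: n B => [|n IHn] B mB.
  by rewrite big_ord0 /= diracE mem_set// => -[].
have [m mE] := lebesgue_rV_sigma_finite_measure n.
rewrite big_ord_recl /= /pushforward.
rewrite (_ : _ @^-1` _ = B ord0 `*`
    [set x : 'rV[R]_n | forall i, B (lift ord0 i) (x ord0 i)]); last first.
  apply/seteqP; split=> -[t x] /=.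
    move=> Btx; split=> [|i].
      by have := Btx ord0; rewrite mxE unlift_none.
    by have := Btx (lift ord0 i); rewrite mxE liftK.
  move=> [Bt Bx] i; rewrite mxE /=.
  by case: unliftP => [j|] ->//; exact: Bx.
rewrite -IHn; last by move=> i; exact: mB.
rewrite mE product_measure1E//.
rewrite (_ : mkset _ = \big[setI/setT]_(i < n)
    ((fun x : 'rV[R]_n => x ord0 i : measurableTypeR R) @^-1` B (lift ord0 i))).
  apply: bigsetI_measurable => i _; rewrite -[X in measurable X]setTI.
  exact: measurable_coor.
rewrite -bigcap_seq; apply/seteqP; split=> x /= Bx i.
  by move=> _; exact: Bx.
by apply: (Bx i) => /=; rewrite mem_index_enum.
Qed.

End lebesgue_rV.

Arguments lebesgue_rV {R} n _.

Section weighted_spaces.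
Context (R : realType) (n : nat).
Implicit Types (A x v : 'rV[R]_n) (f : 'rV[R]_n -> R).

(* The library norm on row vectors is the sup norm. *)
Definition enorm v : R := Num.sqrt (\sum_i v ord0 i ^+ 2).

(* R^n_A *)
Definition orthant A : set 'rV[R]_n :=
  [set x | forall i, 0 < A ord0 i -> 0 < x ord0 i].

(* x^A; the factors with A_i = 0 are equal to 1, also where x_i = 0. *)
Definition monomial A x : R := \prod_i `|x ord0 i| `^ A ord0 i.

(* The integral of h over R^n_A with respect to x^A dx. *)
Definition wintegral A (h : 'rV[R]_n -> R) : \bar R :=
  (\int[lebesgue_rV n]_(x in orthant A) (h x * monomial A x)%:E)%E.

Definition wintegrable A (h : 'rV[R]_n -> R) : Prop :=
  (lebesgue_rV n).-integrable (orthant A) (fun x => (h x * monomial A x)%:E).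

Definition gradient f x : 'rV[R]_n := \row_i 'D_(delta_mx ord0 i) f x.

Definition C1c f : Prop :=
  [/\ forall x, differentiable f x,
      continuous (gradient f)
    & compact (closure [set x | f x != 0])].

Definition H1norm A f (g : 'rV[R]_n -> 'rV[R]_n) : \bar R :=
  (wintegral A (fun x => (`|f x| ^+ 2 + enorm (g x) ^+ 2)%R) `^ 2^-1)%E.

(* f belongs to the closure of C_c^1(R^n) for the weighted H^1 norm, and g is
   its gradient: the limit of the gradients of the approximating functions.
   As the weight is positive on the open set R^n_A, g is determined by f almost
   everywhere there (it is the weak gradient of f). Nothing is required of f
   and g outside of R^n_A. *)
Definition H10 A f (g : 'rV[R]_n -> 'rV[R]_n) : Prop :=
  [/\ measurable_fun (orthant A) f, measurable_fun (orthant A) g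
    & exists phi : ('rV[R]_n -> R)^nat,
        (forall k, C1c (phi k)) /\
        H1norm A (fun x => phi k x - f x) (fun x => gradient (phi k) x - g x)
          @[k --> \oo] --> 0%E].

Definition homdim A : R := n%:R + \sum_i A ord0 i.

End weighted_spaces.

Section constants.
Context (R : realType).

Definition Gamma (s : R) : R :=
  \int[lebesgue_measure]_(t in `]0, +oo[) (t `^ (s - 1) * expR (- t)).

Definition PiA n (A : 'rV[R]_n) : R :=
  (2 ^- #|[pred i | 0 < A ord0 i]| *
     \prod_i Gamma ((A ord0 i + 1) / 2)) `^ (2 / homdim A).

End constants.

(* Main.v *)
Require Import Defs.
From mathcomp Require Import all_boot all_order all_algebra.
From mathcomp Require Import all_classical all_reals all_analysis.
From mathcomp Require Import measurable_realfun ring lra.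
Import Order.TTheory GRing.Theory Num.Theory.
Import numFieldNormedType.Exports.
Local Open Scope classical_set_scope.
Local Open Scope ring_scope.

Set Implicit Arguments.
Unset Strict Implicit.
Unset Printing Implicit Defensive.

(** The inequality is the logarithmic Sobolev inequality for the weight x^A,
    in its Euclidean form, combined with Jensen's inequality.

    In one variable, let w(x) = |x|^a and let f be C^1 on an interval.  Push the
    density f^2 w / m, where m is the integral of f^2 w, forward by the monotone
    map T onto the density w(t) exp(- rho t^2 / 2) / Z.  Taking logarithms in
    the change of variables formula and using ln s <= s - 1 for T' and for
    (T / x)^a gives, pointwise,
      f^2 ln (f^2 / m) w <= (f^2 w T)' - 2 f f' w T - (rho / 2) T^2 f^2 w
                            - (1 + a + ln Z) f^2 w.
    The boundary terms have a favourable sign, and Young's inequality bounds the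
    two middle terms by (2 / rho) f'^2 w.  By the variational formula for the
    entropy this is equivalent to the dual form: for every U > 0,
      int f^2 ln U w <= (2 / rho) int f'^2 w - (1 + a + ln Z) int f^2 w
                        + int f^2 w * ln (int U w)
    ([dual_log_sobolev_interval]).  The dual form passes to products by Fubini
    alone ([dual_log_sobolev_tensor]): apply it in the first variable to U, then
    in the others to the partial integral of U.  The constants 1 + a + ln Z add
    up to D + (D / 2) ln (2 Pi(A) / rho) because Z is a Gamma integral
    ([gauss_mass_approx], [sum_ln_gauss_mass]).

    Taking U = f^2 (up to a small constant) and bounding
    f^2 ln f^2 >= 2 f^2 ln s + 2 f^2 - 2 s |f| with s = int f^2 / int |f|, then
    choosing the best rho, gives the stated constant ([nash_optimization],
    [nash_box]).  This is done on boxes that stay away from the hyperplanes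
    x_i = 0 with A_i > 0; letting them grow covers the orthant ([nash_C1]).

    For f in the closure, the approximating functions converge in the weighted
    H^1 norm but not in L^1.  They are therefore multiplied by exp(- s |x|^2),
    which is square integrable for the weight, so that the L^1 norm of the
    product is controlled by that of f and by the L^2 distance
    ([nash_cutoff]); then s tends to 0 ([nash_closure]). *)

(** * Calculus on an interval and monotone transport *)

Section interval_calculus.
Context {R : realType}.
Implicit Types (f g v T : R -> R) (a b x y t : R).
Notation mu := (@lebesgue_measure R).

Lemma ln_leB1 x : 0 < x -> ln x <= x - 1.
Proof.
by move=> x0; rewrite -{1}(subrKC 1 x); apply: le_ln1Dx; rewrite ltrBrDr addNr.
Qed.

Lemma continuous_itv_integrable f a b :
  continuous f -> mu.-integrable `[a, b] (EFin \o f).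
Proof.
move=> cf; apply: continuous_compact_integrable; first exact: segment_compact.
by apply: continuous_subspaceT => x; exact: cf.
Qed.

Lemma primitive_exists f a : continuous f ->
  exists F, forall x, a < x -> is_derive x 1 F (f x).
Proof.
move=> cf; pose F x := \int[mu]_(t in `[a, x]) f t.
have : forall x, a < x -> derivable F x 1 /\ F^`()%classic x = f x.
  move=> x ax; apply: (@continuous_FTC1_closed R f a x (x + 1)) => //.
  - by rewrite ltrDl.
  - exact: continuous_itv_integrable.
  - exact: cf.
move: F => F dF; exists F => x /dF[dFx <-].
by apply: (DeriveDef dFx); rewrite derive1E.
Qed.

Lemma FTC2_Rintegral f F a b : a < b -> {within `[a, b], continuous f} ->
  (forall x, a <= x <= b -> is_derive x 1 F (f x)) ->
  \int[mu]_(x in `[a, b]) f x = F b - F a.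
Proof.
move=> ab cf dF; rewrite /Rintegral (@continuous_FTC2 _ _ F)//; last first.
  move=> x /[!in_itv]/= /andP[ax xb].
  have [_ <-] := dF x ltac:(by rewrite !ltW).
  by rewrite derive1E.
have cF x : a <= x <= b -> {for x, continuous F}.
  move=> /dF[dFx _]; apply: differentiable_continuous.
  exact/derivable1_diffP.
split.
- move=> x /[!in_itv]/= /andP[ax xb].
  by have [] := dF x ltac:(by rewrite !ltW).
- by apply: cvg_at_right_filter; apply: cF; rewrite lexx ltW.
- by apply: cvg_at_left_filter; apply: cF; rewrite lexx ltW.
Qed.

Lemma is_derive_continuous F x (l : R) : is_derive x 1 F l -> {for x, continuous F}.
Proof.
by move=> [dFx _]; apply: differentiable_continuous; exact/derivable1_diffP.
Qed.

(** If F and G are primitives of v and g, then T is defined by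
    F (T x) - F c = G x - G a.  The density v is positive on the whole line, so
    that the inverse of F is differentiable at the image of the end points too;
    g may vanish, and then so does T'. *)
Lemma transport_map v g a b c d : a < b -> c < d ->
  continuous v -> continuous g -> (forall t, 0 < v t) -> (forall x, 0 <= g x) ->
  \int[mu]_(x in `[a, b]) g x = \int[mu]_(t in `[c, d]) v t ->
  exists T, forall x, a <= x <= b ->
    c <= T x <= d /\ is_derive x 1 T (g x / v (T x)).
Proof.
move=> ab cd cv cg v0 g0 gv.
have [F dF] := primitive_exists (c - 1) cv.
have [G dG] := primitive_exists (a - 1) cg.
have c1 : c - 1 < c by lra.
have a1 : a - 1 < a by lra.
have Fcd : F d - F c = \int[mu]_(t in `[c, d]) v t.
  apply/esym/FTC2_Rintegral => //; first exact: continuous_subspaceT.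
  by move=> x /andP[cx _]; apply: dF; exact: lt_le_trans cx.
have Gab : G b - G a = \int[mu]_(t in `[a, b]) g t.
  apply/esym/FTC2_Rintegral => //; first exact: continuous_subspaceT.
  by move=> x /andP[cx _]; apply: dG; exact: lt_le_trans cx.
have GF : G b - G a = F d - F c by rewrite Gab gv Fcd.
have cF x : c - 1 < x -> {for x, continuous F}.
  by move=> /dF; exact: is_derive_continuous.
have Finc x y : c - 1 < x -> x < y -> F x < F y.
  move=> cx xy; apply: (@gtr0_derive1_incr R F x y) => //.
  - by move=> z /[!in_itv]/= /andP[xz _]; have [] := dF z (lt_trans cx xz).
  - move=> z /[!in_itv]/= /andP[xz _].
    by have [_] := dF z (lt_trans cx xz); rewrite derive1E => ->.
  - apply: derivable_within_continuous => z /[!in_itv]/= /andP[xz _].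
    by have [] := dF z (lt_le_trans cx xz).
have Finj x y : c - 1 < x -> c - 1 < y -> F x = F y -> x = y.
  move=> cx cy Fxy; have [xy|yx|//] := ltgtP x y.
    by have := Finc _ _ cx xy; rewrite Fxy ltxx.
  by have := Finc _ _ cy yx; rewrite Fxy ltxx.
have Ginc x y : a <= x -> x <= y -> G x <= G y.
  move=> ax xy; apply: (@ger0_derive1_ndecr R G x y) => //.
  - move=> z /[!in_itv]/= /andP[xz _].
    by have [] := dG z (lt_trans (lt_le_trans a1 ax) xz).
  - move=> z /[!in_itv]/= /andP[xz _].
    by have [_] := dG z (lt_trans (lt_le_trans a1 ax) xz); rewrite derive1E => ->.
  - apply: derivable_within_continuous => z /[!in_itv]/= /andP[xz _].
    by have [] := dG z (lt_le_trans (lt_le_trans a1 ax) xz).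
(* The primitives are only known to the right of c - 1 and a - 1, hence the restricted inverse. *)
pose K y := xget 0 [set t | c - 1 < t /\ F t = y].
have FK t : c - 1 < t -> K (F t) = t.
  move=> ct; rewrite /K; case: xgetP => [z _ [cz Fz]|/(_ t)[]//].
  exact: Finj.
exists (fun x => K (F c + (G x - G a))) => x /andP[ax xb].
have [t /[!in_itv]/= /andP[ct td] Ft] :
    exists2 t, t \in `[c, d] & F t = F c + (G x - G a).
  apply: IVT; first exact: ltW.
    apply: derivable_within_continuous => z /[!in_itv]/= /andP[xz _].
    by have [] := dF z (lt_le_trans c1 xz).
  have FF : F c < F d by exact: Finc.
  rewrite (min_l (ltW FF)) (max_r (ltW FF)).
  have := Ginc _ _ (lexx a) ax; have := Ginc _ _ ax xb => Gb Ga.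
  by apply/andP; split; lra.
rewrite -Ft FK; last exact: lt_le_trans ct.
split; first by rewrite ct td.
have tc : c - 1 < t by exact: lt_le_trans ct.
rewrite mulrC.
apply: (@is_derive1_comp R K (fun x => F c + (G x - G a))).
  rewrite -Ft; apply: is_derive_inverse; last exact: lt0r_neq0.
  - by near=> s; apply: FK; near: s; exact: lt_nbhsr.
  - by near=> s; apply: cF; near: s; exact: lt_nbhsr.
  - exact: dF.
have := dG x (lt_le_trans a1 ax) => dGx.
have -> : g x = 0 + (g x - 0) by ring.
exact: is_deriveD.
Unshelve. all: by end_near. Qed.

End interval_calculus.

(** * One-dimensional dual logarithmic Sobolev inequality *)

Section interval_log_sobolev.
Context {R : realType}.
Implicit Types (f g v T U : R -> R) (a b x y t rho : R).
Notation mu := (@lebesgue_measure R).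

Definition gauss_weight a rho t : R := `|t| `^ a * expR (- (rho * t ^+ 2 / 2)).

(** Pointwise form of the inequality.  Here S stands for the derivative of
    the transport map at x, xi for T x / x, p for f^2, w and w' for the weight
    at x and T x, and the equation for S is the change of variables formula.
    The last term, from ln q <= q - 1 with q = m U / (u p), is what replaces
    the entropy by its dual form. *)
Lemma entropy_pointwise (p w w' E Z m U u a xi S : R) :
  0 < p -> 0 < w -> 0 < w' -> 0 < Z -> 0 < m -> 0 < U -> 0 < u ->
  S = Z / m * (p * w) / (w' * expR (- E)) ->
  ln w' - ln w <= a * xi - a ->
  ln U - ln u <= S - 1 + (a * xi - a) - E - ln Z + (m / u * U / p - 1).
Proof.
move=> p0 w0 w'0 Z0 m0 U0 u0 SE hw.
have S0 : 0 < S by rewrite SE !(divr_gt0, mulr_gt0)// expR_gt0.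
have lnS : ln S = ln Z - ln m + (ln p + ln w) - (ln w' - E).
  have Ep := expR_gt0 (- E); have Zm := divr_gt0 Z0 m0.
  have pw := mulr_gt0 p0 w0; have wE := mulr_gt0 w'0 Ep.
  have num := mulr_gt0 Zm pw.
  by rewrite SE ln_div ?posrE// lnM ?posrE// ln_div ?posrE// !lnM ?posrE// expRK.
have Q0 : 0 < m / u * U / p by rewrite !(divr_gt0, mulr_gt0).
have lnQ : ln (m / u * U / p) = ln m - ln u + ln U - ln p.
  have mu0 := divr_gt0 m0 u0; have muU := mulr_gt0 mu0 U0.
  by rewrite ln_div ?posrE// lnM ?posrE// ln_div ?posrE.
have := ln_leB1 S0; have := ln_leB1 Q0; rewrite lnS lnQ; lra.
Qed.

(** The alternative a = 0 or 0 < x is shared by all weights below: a factor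
    x_i with A_i > 0 ranges over a half-line, and one with A_i = 0 over the line,
    where the weight is constant. *)
Lemma is_derive_absr_powR a x : (a = 0 \/ 0 < x) ->
  is_derive x 1 (fun t => `|t| `^ a) (a / x * `|x| `^ a).
Proof.
move=> [->|x0].
  under eq_fun do rewrite powRr0.
  by rewrite !mul0r; exact: is_derive_cst.
have -> : a / x * `|x| `^ a = a * x `^ (a - 1).
  rewrite gtr0_norm// powRB ?(gt_eqF x0) ?implybT// powRr1 ?ltW//.
  by rewrite mulrAC mulrA.
have xI : x \in `]0, +oo[ by rewrite in_itv/= x0.
have near_abs : {near x, (fun t => t `^ a) =1 (fun t => `|t| `^ a)}.
  by near=> t; rewrite gtr0_norm//; near: t; exact: lt_nbhsr.
apply: (@near_eq_is_derive _ _ _ (fun t => t `^ a)) => //.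
apply: DeriveDef; first exact: derivable_powR.
by rewrite -derive1E powR_derive1.
Unshelve. all: by end_near. Qed.

Lemma is_derive_mul f g x (df dg : R) : is_derive x 1 f df -> is_derive x 1 g dg ->
  is_derive x 1 (fun y => f y * g y) (df * g x + f x * dg).
Proof.
move=> hf hg; rewrite addrC [df * _]mulrC.
exact: (@is_deriveM R R f g x 1 df dg hf hg).
Qed.

Lemma ln_absr_powRB a x y : 0 <= a -> (a = 0 \/ 0 < x /\ 0 < y) ->
  ln (`|y| `^ a) - ln (`|x| `^ a) <= a * (y / x) - a.
Proof.
move=> a0 [->|[x0 y0]]; first by rewrite !powRr0 ln1 mul0r.
rewrite !ln_powR (gtr0_norm x0) (gtr0_norm y0).
have := ln_leB1 (divr_gt0 y0 x0); rewrite ln_div ?posrE// => /(ler_wpM2l a0).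
lra.
Qed.


Lemma continuous_within f A : (forall x, A x -> {for x, continuous f}) ->
  {within A, continuous f}.
Proof. by move=> cf; apply: continuous_in_subspaceT => x /[!inE]; exact: cf. Qed.

Lemma continuous_sqr (X : topologicalType) (h : X -> R) (p : X) :
  {for p, continuous h} -> {for p, continuous (fun q : X => h q ^+ 2)}.
Proof. by move=> ch; apply: continuousM. Qed.

(** Projection onto the segment from c to d.  Composing with it turns a
    function continuous on the segment into one continuous on the line. *)
Definition clamp c d t : R := Num.max c (Num.min d t).

Lemma clamp_continuous c d : continuous (clamp c d).
Proof.
have h : continuous ((cst c \max (cst d \min (@id R^o))) : R^o -> R^o).
  move=> x; apply: continuous_max; first exact: cst_continuous.
  by apply: continuous_min; [exact: cst_continuous|exact: cvg_id].
exact: h.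
Qed.

Lemma Rintegral_continuous_gt0 f a b : a < b -> continuous f ->
  (forall x, 0 < f x) -> 0 < \int[mu]_(x in `[a, b]) f x.
Proof.
move=> ab cf f0; have a1 : a - 1 < a by rewrite ltrBlDr ltrDl.
have [F dF] := primitive_exists (a - 1) cf.
have -> : \int[mu]_(x in `[a, b]) f x = F b - F a.
  apply: FTC2_Rintegral => //; first exact: continuous_subspaceT.
  by move=> x /andP[ax _]; apply: dF; exact: lt_le_trans ax.
rewrite subr_gt0; apply: (@gtr0_derive1_incr R F a b) => //.
- by move=> z /[!in_itv]/= /andP[xz _]; have [] := dF z (lt_trans a1 xz).
- move=> z /[!in_itv]/= /andP[xz _].
  by have [_] := dF z (lt_trans a1 xz); rewrite derive1E => ->.
- apply: derivable_within_continuous => z /[!in_itv]/= /andP[xz _].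
  by have [] := dF z (lt_le_trans a1 xz).
Qed.

Lemma clamp_in c d t : c <= d -> c <= clamp c d t <= d.
Proof.
move=> cd; rewrite /clamp le_max lexx/= ge_max cd/=.
by rewrite ge_min lexx.
Qed.

Lemma clampE c d t : c <= t <= d -> clamp c d t = t.
Proof. by move=> /andP[ct td]; rewrite /clamp min_r// max_r. Qed.

Lemma continuous_absr_powR a x : (a = 0 \/ 0 < x) ->
  {for x, continuous (fun t => `|t| `^ a)}.
Proof. by move=> /(@is_derive_absr_powR a); exact: is_derive_continuous. Qed.

Lemma continuous_gauss_weight a rho x : (a = 0 \/ 0 < x) ->
  {for x, continuous (gauss_weight a rho)}.
Proof.
move=> ax; apply: continuousM; first exact: continuous_absr_powR.
apply: continuous_comp; last exact: continuous_expR.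
apply: continuousN; apply: continuousM; last exact: cst_continuous.
apply: continuousM; first exact: cst_continuous.
exact: exprn_continuous.
Qed.

Lemma absr_powR_gt0 a x : (a = 0 \/ 0 < x) -> 0 < `|x| `^ a.
Proof.
by move=> [->|x0]; [rewrite powRr0|rewrite powR_gt0// normr_gt0 gt_eqF].
Qed.

Lemma gauss_weight_gt0 a rho x : (a = 0 \/ 0 < x) -> 0 < gauss_weight a rho x.
Proof. by move=> ax; rewrite mulr_gt0 ?expR_gt0// absr_powR_gt0. Qed.

Definition pow_integral a x1 x2 g : R :=
  \int[mu]_(x in `[x1, x2]) (g x * `|x| `^ a).

(** One-dimensional inequality with a truncated Gaussian target.  The source
    and target segments are compact and, if a > 0, away from 0, so that all
    functions involved are bounded.  The boundary term f^2 w T vanishes at x2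
    because f does; at x1 it vanishes if a = 0, and it is nonnegative if a > 0
    because T is then positive. *)
Lemma dual_log_sobolev_interval a rho x1 x2 t1 t2 f f' U (c C : R) :
  0 <= a -> 0 < rho -> x1 < x2 -> t1 < t2 -> (a = 0 \/ 0 < x1 /\ 0 < t1) ->
  (forall x, is_derive x 1 f (f' x)) -> continuous f' ->
  f x2 = 0 -> (a = 0 -> f x1 = 0) ->
  measurable_fun setT U -> 0 < c -> (forall x, c <= U x <= C) ->
  pow_integral a x1 x2 (fun x => f x ^+ 2 * ln (U x)) <=
  2 / rho * pow_integral a x1 x2 (fun x => f' x ^+ 2)
  - (1 + a + ln (\int[mu]_(t in `[t1, t2]) gauss_weight a rho t)) * pow_integral a x1 x2 (fun x => f x ^+ 2)
  + pow_integral a x1 x2 (fun x => f x ^+ 2) * ln (pow_integral a x1 x2 U).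
Proof.
move=> a0 rho0 x12 t12 xt0 df cf' fx2 fx1 mU c0 cUC; set I := pow_integral a x1 x2.
have xpos x : x1 <= x -> a = 0 \/ 0 < x.
  by case: xt0 => [?|[x10 _] x1x]; [left|right; exact: lt_le_trans x1x].
have tpos t : t1 <= t -> a = 0 \/ 0 < t.
  by case: xt0 => [?|[_ t10] tt]; [left|right; exact: lt_le_trans tt].
have xtpos x t : x1 <= x -> t1 <= t -> a = 0 \/ 0 < x /\ 0 < t.
  move=> /xpos[?|?] /tpos[?|?]; [left|left|left|right] => //.
set Z := \int[mu]_(t in _) _.
have cf : continuous f by move=> x; exact: is_derive_continuous (df x).
have mIx : measurable (`[x1, x2] : set (measurableTypeR R)) by [].
pose w x := `|clamp x1 x2 x| `^ a.
pose v t := gauss_weight a rho (clamp t1 t2 t).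
have wpos x : 0 < w x.
  by apply/absr_powR_gt0/xpos; have /andP[] := clamp_in x (ltW x12).
have vpos t : 0 < v t.
  by apply/gauss_weight_gt0/tpos; have /andP[] := clamp_in t (ltW t12).
have cw : continuous w.
  move=> x; apply: (@continuous_comp _ _ _ (clamp x1 x2) (fun t => `|t| `^ a)).
    exact: clamp_continuous.
  by apply/continuous_absr_powR/xpos; have /andP[] := clamp_in x (ltW x12).
have cv : continuous v.
  move=> x; apply: (@continuous_comp _ _ _ (clamp t1 t2) (gauss_weight a rho)).
    exact: clamp_continuous.
  by apply/continuous_gauss_weight/tpos; have /andP[] := clamp_in x (ltW t12).
have Iw g : I g = \int[mu]_(x in `[x1, x2]) (g x * w x).
  apply: eq_Rintegral => x; rewrite inE/= in_itv/= => xx.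
  by rewrite /w clampE.
have ZE : Z = \int[mu]_(t in `[t1, t2]) v t.
  apply: eq_Rintegral => x; rewrite inE/= in_itv/= => xx.
  by rewrite /v clampE.
have Z0 : 0 < Z by rewrite ZE; exact: Rintegral_continuous_gt0.
have iw : mu.-integrable `[x1, x2] (EFin \o w) by exact: continuous_itv_integrable.
pose L1 g := mu.-integrable `[x1, x2] (EFin \o (fun x => g x * w x)).
have L1bnd g (M : R) : measurable_fun setT g -> (forall x, `|g x| <= M) -> L1 g.
  move=> mg gM.
  have := @integrableMr _ _ _ mu _ mIx g (EFin \o w) (measurable_funTS mg) _ iw.
  apply; exists M; split; first exact: num_real.
  by move=> y My x _; exact: le_trans (gM x) (ltW My).
have L1c g : continuous g -> L1 g.
  move=> cg; apply: continuous_itv_integrable => x.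
  by apply: continuousM; [exact: cg|exact: cw].
have C0 : 0 < C by have /andP[cU UC] := cUC 0; exact: lt_le_trans c0 (le_trans cU UC).
have Upos x : 0 < U x by have /andP[cU _] := cUC x; exact: lt_le_trans cU.
pose K := `|ln c| + `|ln C|.
have lnUK x : `|ln (U x)| <= K.
  have /andP[cU UC] := cUC x.
  have h1 : ln c <= ln (U x) by rewrite ler_ln ?posrE.
  have h2 : ln (U x) <= ln C by rewrite ler_ln ?posrE.
  have := ler_norm (ln C); have := ler_norm (- ln c); rewrite normrN /K => h3 h4.
  have := normr_ge0 (ln C); have := normr_ge0 (ln c) => h5 h6.
  by rewrite ler_norml; apply/andP; split; lra.
have mlnU : measurable_fun setT (fun x => ln (U x)) by exact: (measurableT_comp (@measurable_ln R) mU).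
have cf2 : continuous (fun x => f x ^+ 2).
  by move=> x; exact/continuous_sqr/cf.
have L1U : L1 U.
  by apply: (L1bnd _ C) => // x; rewrite gtr0_norm//; have /andP[] := cUC x.
have L1f : L1 (fun x => f x ^+ 2) by exact: L1c.
have L1f' : L1 (fun x => f' x ^+ 2).
  by apply: L1c => x; exact/continuous_sqr/cf'.
have L1fU : L1 (fun x => f x ^+ 2 * ln (U x)).
  have := @integrableMl _ _ _ mu _ mIx _ (fun x => ln (U x)) L1f (measurable_funTS mlnU) _.
  have bU : [bounded ln (U x) | x in `[x1, x2]].
    exists K; split; first exact: num_real.
    by move=> y My x _; exact: le_trans (lnUK x) (ltW My).
  by move=> /(_ bU); apply: eq_integrable => // x _ /=; rewrite -EFinM mulrAC.
set m := I (fun x => f x ^+ 2).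
set u := I U.
have m_ge0 : 0 <= m.
  rewrite /m Iw; apply: Rintegral_ge0 => x _.
  exact: mulr_ge0 (sqr_ge0 _) (ltW (wpos x)).
have E_ge0 : 0 <= I (fun x => f' x ^+ 2).
  rewrite Iw; apply: Rintegral_ge0 => x _.
  exact: mulr_ge0 (sqr_ge0 _) (ltW (wpos x)).
have u0 : 0 < u.
  apply: (@lt_le_trans _ _ (c * \int[mu]_(x in `[x1, x2]) w x)).
    by rewrite mulr_gt0// Rintegral_continuous_gt0.
  rewrite /u Iw -(RintegralZl c mIx iw).
  apply: (le_Rintegral mIx _ L1U); first by apply: (L1bnd (cst c) `|c|).
  by move=> x _; apply: ler_wpM2r; [exact: ltW|have /andP[] := cUC x].
(* If f vanishes almost everywhere there is nothing to transport. *)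
have [m0|m0] := leP m 0.
  have {}m0 : m = 0 by apply/eqP; rewrite eq_le m0 m_ge0.
  rewrite m0 mulr0 mul0r addr0 subr0.
  apply: (@le_trans _ _ 0); last exact: mulr_ge0 (divr_ge0 (ler0n _ 2) (ltW rho0)) E_ge0.
  have : I (fun x => f x ^+ 2 * ln (U x)) <= K * m.
    rewrite /m !Iw -(RintegralZl K mIx L1f).
    apply: (le_Rintegral mIx L1fU).
      have := @integrableZl _ _ _ mu _ mIx K _ L1f.
      by apply: eq_integrable.
    move=> x _; rewrite mulrA; apply: ler_wpM2r; first exact: ltW.
    rewrite mulrC; apply: ler_wpM2r; first exact: sqr_ge0.
    exact: le_trans (ler_norm _) (lnUK x).
  by rewrite m0 mulr0.
have L1D g1 g2 : L1 g1 -> L1 g2 -> L1 (fun x => g1 x + g2 x).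
  move=> h1 h2; have := @integrableD _ _ _ mu _ mIx _ _ h1 h2.
  by apply: eq_integrable => // x _ /=; rewrite mulrDl.
have L1Z k g1 : L1 g1 -> L1 (fun x => k * g1 x).
  move=> h1; have := @integrableZl _ _ _ mu _ mIx k _ h1.
  by apply: eq_integrable => // x _ /=; rewrite -EFinM mulrA.
have ID g1 g2 : L1 g1 -> L1 g2 -> I (fun x => g1 x + g2 x) = I g1 + I g2.
  move=> h1 h2; rewrite !Iw -(RintegralD mIx h1 h2).
  by apply: eq_Rintegral => x _; rewrite mulrDl.
have IZ k g1 : L1 g1 -> I (fun x => k * g1 x) = k * I g1.
  move=> h1; rewrite !Iw -(RintegralZl k mIx h1).
  by apply: eq_Rintegral => x _; rewrite mulrA.
(* Both densities are given the same mass Z. *)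
pose g x := f x ^+ 2 * w x * (Z / m).
have Zm : 0 < Z / m by rewrite divr_gt0.
have cgx x : {for x, continuous g}.
  apply: continuousM; last exact: cst_continuous.
  by apply: continuousM; [exact: cf2|exact: cw].
have cg : continuous g by exact: cgx.
have g0 x : 0 <= g x.
  exact: mulr_ge0 (mulr_ge0 (sqr_ge0 _) (ltW (wpos x))) (ltW Zm).
have gv : \int[mu]_(x in `[x1, x2]) g x = \int[mu]_(t in `[t1, t2]) v t.
  by rewrite (RintegralZr _ mIx L1f) -ZE -Iw -/m mulrC divfK// gt_eqF.
have [T HT] := transport_map x12 t12 cv cg vpos g0 gv.
(* The product hh w is the derivative of H = f^2 w T. *)
pose hh x := 2 * f x * f' x * T x + f x ^+ 2 * (a / x) * T x + f x ^+ 2 * (g x / v (T x)).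
have cT x : x1 <= x <= x2 -> {for x, continuous T}.
  by move=> /HT[_]; exact: is_derive_continuous.
have chh : {within `[x1, x2], continuous (fun x => hh x * w x)}.
  apply: continuous_within => x /=; rewrite in_itv/= => xx.
  have cTx := cT x xx.
  have cfx := cf x; have cf'x := cf' x; have cf2x := cf2 x; have cwx := cw x.
  have cax : {for x, continuous (fun x => a / x)}.
    have [->|x0] := xpos x (proj1 (andP xx)).
      have -> : (fun y : R => 0 / y) = cst 0 by apply/funext => y; rewrite mul0r.
      exact: cst_continuous.
    apply: continuousM; first exact: cst_continuous.
    by apply: continuousV; rewrite ?gt_eqF.
  apply: continuousM => //; apply: continuousD; first apply: continuousD.
  - apply: continuousM => //; apply: continuousM => //; apply: continuousM => //.
    exact: cst_continuous.
  - by apply: continuousM => //; apply: continuousM.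
  - apply: continuousM => //; apply: continuousM; first exact: cg.
    apply: continuousV; first by rewrite gt_eqF.
    by apply: (@continuous_comp _ _ _ T v) => //; exact: cv.
pose H x := f x ^+ 2 * `|x| `^ a * T x.
have dH x : x1 <= x <= x2 -> is_derive x 1 H (hh x * w x).
  move=> xx; have [_ dT] := HT x xx; have dfx := df x.
  have dW := is_derive_absr_powR (xpos x (proj1 (andP xx))).
  have df2 : is_derive x 1 (fun x => f x ^+ 2) (2 * f x * f' x).
    have -> : 2 * f x * f' x = f' x * f x + f x * f' x by ring.
    exact: is_derive_mul.
  have -> : hh x * w x =
      (2 * f x * f' x * `|x| `^ a + f x ^+ 2 * (a / x * `|x| `^ a)) * T x +
      f x ^+ 2 * `|x| `^ a * (g x / v (T x)).
    by rewrite /hh /w clampE//; ring.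
  exact: (is_derive_mul (is_derive_mul df2 dW) dT).
have IH : I hh = H x2 - H x1 by rewrite Iw; apply: FTC2_Rintegral.
have L1hh : L1 hh.
  by apply: continuous_compact_integrable => //; exact: segment_compact.
have H2 : H x2 = 0 by rewrite /H fx2 expr0n/= !mul0r.
have H1 : 0 <= H x1.
  rewrite /H; case: xt0 => [/fx1 ->|[x10 t10]]; first by rewrite expr0n/= !mul0r.
  apply: mulr_ge0; first exact: mulr_ge0 (sqr_ge0 _) (powR_ge0 _ _).
  have /andP[t1T _] := (HT x1 ltac:(by rewrite lexx ltW)).1.
  exact: ltW (lt_le_trans t10 t1T).
have key x : `[x1, x2]%classic x ->
   f x ^+ 2 * ln (U x) + (- ln u) * f x ^+ 2 <=
   hh x + (2 / rho * f' x ^+ 2 + (- (2 + a + ln Z) * f x ^+ 2 + m / u * U x)).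
  rewrite /= in_itv/= => xx.
  have mu0 : 0 < m / u by rewrite divr_gt0.
  have [fx0|fx0] := eqVneq (f x) 0.
    rewrite /hh fx0 expr0n/= !(mulr0, mul0r, add0r).
    apply: addr_ge0; last exact: mulr_ge0 (ltW mu0) (ltW (Upos x)).
    exact: mulr_ge0 (divr_ge0 (ler0n _ 2) (ltW rho0)) (sqr_ge0 _).
  have f20 : 0 < f x ^+ 2 by rewrite exprn_even_gt0.
  have [/andP[t1T Tt2] _] := HT x xx.
  have vT : v (T x) = `|T x| `^ a * expR (- (rho * T x ^+ 2 / 2)).
    by rewrite /v clampE ?t1T.
  have := @entropy_pointwise (f x ^+ 2) (w x) (`|T x| `^ a) (rho * T x ^+ 2 / 2)
    Z m (U x) u a (T x / x) (g x / v (T x)) f20 (wpos x)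
    (absr_powR_gt0 (tpos _ t1T)) Z0 m0 (Upos x) u0.
  have -> : g x / v (T x) = Z / m * (f x ^+ 2 * w x) /
      (`|T x| `^ a * expR (- (rho * T x ^+ 2 / 2))).
    by rewrite vT /g (mulrC (Z / m)).
  move=> /(_ erefl); rewrite -vT.
  have wE : w x = `|x| `^ a by rewrite /w clampE.
  rewrite wE => /(_ (ln_absr_powRB a0 (xtpos _ _ (proj1 (andP xx)) t1T))).
  rewrite -wE.
  have -> : Z / m * (f x ^+ 2 * w x) / v (T x) = g x / v (T x).
    by rewrite /g (mulrC (Z / m)).
  rewrite /hh; set S := g x / v (T x) => /(ler_wpM2l (ltW f20)) ineq.
  have e1 : f x ^+ 2 * (m / u * U x / f x ^+ 2 - 1) = m / u * U x - f x ^+ 2.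
    by rewrite mulrBr mulr1 mulrC divfK// gt_eqF.
  have e2 : 0 <= rho / 2 * (T x * f x + 2 / rho * f' x) ^+ 2.
    exact: mulr_ge0 (divr_ge0 (ltW rho0) (ler0n _ 2)) (sqr_ge0 _).
  have e3 : rho / 2 * (T x * f x + 2 / rho * f' x) ^+ 2 =
    rho / 2 * (T x ^+ 2 * f x ^+ 2) + 2 * f x * f' x * T x + 2 / rho * f' x ^+ 2.
    by field; rewrite gt_eqF.
  rewrite e3 in e2.
  rewrite (mulrDr _ _ (m / u * U x / f x ^+ 2 - 1)) e1 in ineq.
  have e4 : f x ^+ 2 * (S - 1 + (a * (T x / x) - a) - rho * T x ^+ 2 / 2 - ln Z) =
    f x ^+ 2 * (a / x) * T x + f x ^+ 2 * S - (1 + a + ln Z) * f x ^+ 2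
     - rho / 2 * (T x ^+ 2 * f x ^+ 2) by ring.
  rewrite e4 in ineq; lra.
have R1 := L1Z (2 / rho) _ L1f'; have R2 := L1Z (- (2 + a + ln Z)) _ L1f.
have R3 := L1Z (m / u) _ L1U; have R4 := L1Z (- ln u) _ L1f.
have R23 := L1D _ _ R2 R3; have R123 := L1D _ _ R1 R23.
have fin : I (fun x => f x ^+ 2 * ln (U x) + (- ln u) * f x ^+ 2) <=
  I (fun x => hh x + (2 / rho * f' x ^+ 2 + (- (2 + a + ln Z) * f x ^+ 2 + m / u * U x))).
  rewrite !Iw; apply: (le_Rintegral mIx (L1D _ _ L1fU R4) (L1D _ _ L1hh R123)).
  by move=> x xx; apply: ler_wpM2r (ltW (wpos x)) _ _ (key x xx).
move: fin; rewrite (ID _ _ L1fU R4) (ID _ _ L1hh R123) (ID _ _ R1 R23) (ID _ _ R2 R3).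
rewrite (IZ _ _ L1f') !(IZ _ _ L1f) (IZ _ _ L1U) IH H2 -/m -/u divfK ?gt_eqF//; lra.
Qed.

End interval_log_sobolev.

(** * Mass of the Gaussian weight and the Gamma function *)

Section gauss_mass.
Context {R : realType}.
Implicit Types (f g v T U : R -> R) (a b x t rho : R).
Notation mu := (@lebesgue_measure R).

Lemma gauss_weight_ge0 a rho t : 0 <= gauss_weight a rho t.
Proof. exact: mulr_ge0 (powR_ge0 _ _) (expR_ge0 _). Qed.

Lemma measurable_absr_powR a : measurable_fun setT (fun t : R => `|t| `^ a).
Proof. exact: (measurableT_comp (@measurable_powR R a) (@normr_measurable R setT)). Qed.

Lemma measurable_gauss_weight a rho : measurable_fun setT (gauss_weight a rho).
Proof.
apply: measurable_funM; first exact: measurable_absr_powR.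
apply: (measurableT_comp (@measurable_expR R)).
apply: measurableT_comp => //; apply: measurable_funM => //.
by apply: measurable_funM => //; exact: measurable_funX.
Qed.

(** From |t|^a <= exp(a |t|) and a |t| <= a^2 / rho + rho t^2 / 4. *)
Lemma gauss_weight_le a rho t : 0 <= a -> 0 < rho ->
  gauss_weight a rho t <= expR (a ^+ 2 / rho) * expR (- (rho * t ^+ 2 / 4)).
Proof.
move=> a0 rho0.
have tE : `|t| `^ a <= expR (a * `|t|).
  have [->|t0] := eqVneq t 0.
    rewrite normr0 mulr0 expR0; have [->|a00] := eqVneq a 0; first by rewrite powRr0.
    by rewrite powR0// ler01.
  have t0' : 0 < `|t| by rewrite normr_gt0.
  rewrite -[X in X <= _]lnK ?posrE ?powR_gt0// ler_expR ln_powR.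
  rewrite ler_wpM2l//; exact: ltW (ln_sublinear t0').
apply: (@le_trans _ _ (expR (a * `|t|) * expR (- (rho * t ^+ 2 / 2)))).
  by rewrite ler_wpM2r ?expR_ge0.
rewrite -!expRD ler_expR -real_normK ?num_real//; set s := `|t|.
have : 0 <= rho * (s / 2 - a / rho) ^+ 2 := mulr_ge0 (ltW rho0) (sqr_ge0 _).
have -> : rho * (s / 2 - a / rho) ^+ 2 = rho * s ^+ 2 / 4 - a * s + a ^+ 2 / rho.
  by field; rewrite gt_eqF.
lra.
Qed.

Lemma integrable_gauss_weight a rho : 0 <= a -> 0 < rho ->
  mu.-integrable setT (EFin \o gauss_weight a rho).
Proof.
move=> a0 rho0; set s := Num.sqrt (2 / rho).
have s2 : s ^+ 2 = 2 / rho by rewrite sqr_sqrtr// divr_ge0// ltW.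
have s0 : s != 0 by rewrite gt_eqF// sqrtr_gt0 divr_gt0.
have pk0 := normal_peak_gt0 s0.
have iN := integrable_normal_pdf 0 s.
have mT : measurable (setT : set (measurableTypeR R)) by [].
have iN2 := @integrableZl _ _ _ mu _ mT (expR (a ^+ 2 / rho) / normal_peak s) _ iN.
apply: le_integrable iN2 => //.
  by apply/measurable_EFinP; exact: measurable_gauss_weight.
move=> t _ /=; rewrite lee_fin (ger0_norm (gauss_weight_ge0 _ _ _)).
apply: le_trans (gauss_weight_le t a0 rho0) _; apply: le_trans _ (ler_norm _).
rewrite /normal_pdf (negbTE s0) /normal_fun /=.
rewrite [leRHS]mulrA divfK ?gt_eqF// subr0 s2.
rewrite ler_pM2l ?expR_gt0// ler_expR le_eqVlt; apply/orP; left; apply/eqP.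
by field; rewrite gt_eqF.
Qed.

(** Monotone convergence along the segments from 1/(k+1) to k+2.  A uniform
    bound on compact segments makes the improper integral finite, which matters
    because the real-valued integral of a function with infinite integral
    is 0. *)
Lemma ge0_integral_oy_exhaustion g (M : R) : measurable_fun setT g -> (forall x, 0 <= g x) ->
  (forall p q, 0 < p -> p < q -> (\int[mu]_(x in `[p, q]) (g x)%:E <= M%:E)%E) ->
  let G := \int[mu]_(x in `]0, +oo[) g x in
  (\int[mu]_(x in `]0%R, +oo[) (g x)%:E = G%:E)%E /\
  forall e, 0 < e -> exists p q, [/\ 0 < p, p < q &
    G - e < \int[mu]_(x in `[p, q]) g x].
Proof.
move=> mg g0 gM G.
pose F k : set (measurableTypeR R) := `[k.+1%:R^-1, k.+2%:R]%classic.
have pq k : k.+1%:R^-1 < k.+2%:R :> R.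
  by rewrite (@le_lt_trans _ _ 1) ?ltr1n// invf_le1 ?ler1n.
have ndF : nondecreasing_seq F.
  move=> i j ij; apply/subsetPset => x; rewrite /F /= !in_itv/= => /andP[h1 h2].
  apply/andP; split; last by rewrite (le_trans h2)// ler_nat.
  by rewrite (le_trans _ h1)// lef_pV2 ?posrE// ler_nat.
have UF : \bigcup_i F i = `]0, +oo[%classic.
  apply/seteqP; split=> x /=.
    by move=> [i _]; rewrite /F /= !in_itv/= andbT => /andP[h1 _]; exact: lt_le_trans h1.
  rewrite in_itv/= andbT => x0.
  have [i hi] : exists i, x + x^-1 < i.+1%:R.
    by exists (Num.truncn (x + x^-1)); exact: truncnS_gt.
  exists i => //; rewrite /F /= in_itv/=; apply/andP; split.
    rewrite invf_ple ?posrE//; apply/ltW/(lt_trans _ hi).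
    by rewrite ltrDr.
  apply/ltW/(lt_le_trans (_ : x < i.+1%:R)); last by rewrite ler_nat.
  by rewrite (lt_trans _ hi)// ltrDl invr_gt0.
have mgE (A : set (measurableTypeR R)) : measurable_fun A (EFin \o g).
  by apply/measurable_EFinP; exact: measurable_funTS.
have cvgF := @ge0_nondecreasing_set_cvg_integral _ (measurableTypeR R) R F (EFin \o g) mu ndF
   (fun i => measurable_itv _) (fun i => mgE _) (fun i x _ => g0 x).
rewrite UF in cvgF.
have leM : (\int[mu]_(x in `]0%R, +oo[) (g x)%:E <= M%:E)%E.
  rewrite -(cvg_lim _ cvgF)//; apply: lime_le.
    by apply/cvg_ex; eexists; exact: cvgF.
  by near=> k; apply: gM => //; exact: pq.
have fin : (\int[mu]_(x in `]0%R, +oo[) (g x)%:E)%E \is a fin_num.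
  rewrite ge0_fin_numE; last by apply: integral_ge0 => x _; rewrite lee_fin.
  exact: le_lt_trans leM (ltry _).
have GE : (\int[mu]_(x in `]0%R, +oo[) (g x)%:E = G%:E)%E by rewrite /G /Rintegral fineK.
split=> // e e0.
have lt1 : ((G - e)%:E < \int[mu]_(x in `]0%R, +oo[) (g x)%:E)%E.
  by rewrite GE lte_fin ltrBlDr ltrDl.
have [k _ hk] : \forall k \near \oo, ((G - e)%:E < \int[mu]_(x in F k) (g x)%:E)%E.
  exact: (cvgF _ (open_ereal_gt' lt1)).
exists k.+1%:R^-1, k.+2%:R; split => //.
have := hk k (leqnn k); rewrite -lte_fin /Rintegral fineK//.
rewrite ge0_fin_numE; last by apply: integral_ge0 => x _; rewrite lee_fin.
by apply: le_lt_trans (gM _ _ _ _) (ltry _).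
Unshelve. all: by end_near. Qed.


Lemma clamp_continuous_comp f c d : c <= d ->
  (forall x, c <= x <= d -> {for x, continuous f}) ->
  continuous (fun x => f (clamp c d x)).
Proof.
move=> cd cf x; apply: (@continuous_comp _ _ _ (clamp c d) f).
  exact: clamp_continuous.
exact/cf/clamp_in.
Qed.

Lemma eq_Rintegral_clamp f c d :
  \int[mu]_(x in `[c, d]) f (clamp c d x) = \int[mu]_(x in `[c, d]) f x.
Proof.
by apply: eq_Rintegral => x; rewrite inE/= in_itv/= => xx; rewrite clampE.
Qed.

Lemma Rintegral_itv_gt0 f a b : a < b ->
  (forall x, a <= x <= b -> {for x, continuous f}) ->
  (forall x, a <= x <= b -> 0 < f x) -> 0 < \int[mu]_(x in `[a, b]) f x.
Proof.
move=> ab cf f0; rewrite -eq_Rintegral_clamp; apply: Rintegral_continuous_gt0 => //.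
  exact: clamp_continuous_comp (ltW ab) cf.
by move=> x; exact/f0/clamp_in/ltW.
Qed.

Lemma Rintegral_subst g (F F' : R -> R) x1 x2 : x1 < x2 -> F x1 < F x2 ->
  (forall x, x1 <= x <= x2 -> is_derive x 1 F (F' x)) ->
  (forall x, x1 <= x <= x2 -> F x1 <= F x <= F x2) ->
  (forall x, x1 <= x <= x2 -> {for x, continuous F'}) ->
  (forall t, F x1 <= t <= F x2 -> {for t, continuous g}) ->
  \int[mu]_(t in `[F x1, F x2]) g t = \int[mu]_(x in `[x1, x2]) (g (F x) * F' x).
Proof.
move=> x12 F12 dF Fin cF' cg.
have cG := clamp_continuous_comp (ltW F12) cg.
have [P dP] := primitive_exists (F x1 - 1) cG.
have F1 : F x1 - 1 < F x1 by rewrite ltrBlDr ltrDl.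
rewrite -eq_Rintegral_clamp (_ : \int[mu]_(x in `[F x1, F x2]) _ = P (F x2) - P (F x1)).
  apply/esym; apply: (@FTC2_Rintegral R _ (P \o F)) => //.
    apply: continuous_within => x /=; rewrite in_itv/= => xx.
    apply: continuousM; last exact: cF'.
    apply: (@continuous_comp _ _ _ F g); last exact/cg/Fin.
    exact: is_derive_continuous (dF x xx).
  move=> x xx; have /andP[h1 h2] := Fin x xx.
  rewrite -[in g _](@clampE _ (F x1) (F x2) (F x)) ?Fin//.
  by apply: is_derive1_comp; [apply: dP; exact: lt_le_trans h1|exact: dF].
apply: FTC2_Rintegral => //; first exact: continuous_subspaceT.
by move=> x /andP[ax _]; apply: dP; exact: lt_le_trans ax.
Qed.

Definition gamma_fun (s t : R) : R := t `^ (s - 1) * expR (- t).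

Lemma gamma_fun_ge0 s t : 0 <= gamma_fun s t.
Proof. exact: mulr_ge0 (powR_ge0 _ _) (expR_ge0 _). Qed.

Lemma measurable_gamma_fun s : measurable_fun setT (gamma_fun s).
Proof.
apply: measurable_funM; first exact: measurable_powR.
apply: (measurableT_comp (@measurable_expR R)).
exact: oppr_measurable.
Qed.

Lemma gamma_fun_continuous s t : 0 < t -> {for t, continuous (gamma_fun s)}.
Proof.
move=> t0; apply: continuousM.
  apply/differentiable_continuous/derivable1_diffP.
  by apply: derivable_powR; rewrite in_itv/= t0.
apply: continuous_comp; last exact: continuous_expR.
exact: continuousN.
Qed.

(** Substitution t = rho r^2 / 2. *)
Lemma gamma_gauss_subst a rho x1 x2 : 0 <= a -> 0 < rho -> 0 < x1 -> x1 < x2 ->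
  \int[mu]_(t in `[rho * x1 ^+ 2 / 2, rho * x2 ^+ 2 / 2]) gamma_fun ((a + 1) / 2) t =
  2 * (rho / 2) `^ ((a + 1) / 2) * \int[mu]_(r in `[x1, x2]) gauss_weight a rho r.
Proof.
move=> a0 rho0 x10 x12; have x20 := lt_trans x10 x12.
pose F x := rho * x ^+ 2 / 2.
have Fmono x y : 0 < x -> x <= y -> F x <= F y.
  move=> x0 xy; rewrite /F ler_pM2r ?invr_gt0// ler_pM2l// ler_sqr ?nnegrE ?(ltW x0)//.
  exact: le_trans (ltW x0) xy.
have F12 : F x1 < F x2.
  by rewrite /F ltr_pM2r ?invr_gt0// ltr_pM2l// ltr_sqr ?nnegrE ?ltW.
have dF x : is_derive x 1 F (rho * x).
  have h := @is_derive_mul R id id x 1 1 (is_derive_id _ _) (is_derive_id _ _).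
  have h2 := @is_derive_mul R (cst (rho / 2)) _ x 0 _ (is_derive_cst _ _ _) h.
  have -> : F = (fun y => cst (rho / 2) y * (id y * id y)).
    by apply/funext => y; rewrite /F/= expr2; field.
  have -> : rho * x = 0 * (id x * id x) + cst (rho / 2) x * (1 * id x + id x * 1).
    by rewrite /=; field.
  exact: h2.
rewrite (@Rintegral_subst _ F (fun x => rho * x))//; last 3 first.
- by move=> x /andP[h1 h2]; rewrite !Fmono//; exact: lt_le_trans h1.
- move=> x _; apply: continuousM; [exact: cst_continuous|exact: cvg_id].
- move=> t /andP[h1 _]; apply: gamma_fun_continuous; apply: lt_le_trans h1.
  by rewrite /F divr_gt0// mulr_gt0// exprn_gt0.
rewrite -RintegralZl//; last first.
  apply: continuous_compact_integrable; first exact: segment_compact.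
  apply: continuous_within => x /=; rewrite in_itv/= => /andP[h1 _].
  by apply: continuous_gauss_weight; right; exact: lt_le_trans h1.
apply: eq_Rintegral => x; rewrite inE/= in_itv/= => /andP[h1 _].
have x0 : 0 < x := lt_le_trans x10 h1.
have s0 : 0 < (a + 1) / 2 by rewrite divr_gt0// ltr_wpDl.
have r2 : 0 < rho / 2 by rewrite divr_gt0.
rewrite /gamma_fun /gauss_weight /F gtr0_norm//.
have -> : rho * x ^+ 2 / 2 = rho / 2 * x ^+ 2 by rewrite mulrAC.
rewrite powRM ?(ltW r2) ?sqr_ge0//.
rewrite -(mulr_powRB1 (ltW r2) s0) -powR_mulrn ?(ltW x0)// -powRrM.
have -> : 2 * ((a + 1) / 2 - 1) = a - 1 by field.
have -> : x `^ a = x `^ (a - 1) * x.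
  by rewrite powRB ?(gt_eqF x0) ?implybT// powRr1 ?ltW// divfK// gt_eqF.
by field.
Qed.


Lemma square_preimage rho p : 0 < rho -> 0 < p ->
  exists2 x, 0 < x & p = rho * x ^+ 2 / 2.
Proof.
move=> rho0 p0; have h : 0 < 2 * p / rho by rewrite divr_gt0// mulr_gt0.
exists (Num.sqrt (2 * p / rho)); first by rewrite sqrtr_gt0.
by rewrite sqr_sqrtr ?ltW//; field; rewrite gt_eqF.
Qed.

Lemma gamma_fun_itv a rho p q : 0 <= a -> 0 < rho -> 0 < p -> p < q ->
  exists x1 x2, [/\ 0 < x1, x1 < x2 &
    \int[mu]_(t in `[p, q]) gamma_fun ((a + 1) / 2) t =
    2 * (rho / 2) `^ ((a + 1) / 2) * \int[mu]_(r in `[x1, x2]) gauss_weight a rho r].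
Proof.
move=> a0 rho0 p0 pq; have q0 := lt_trans p0 pq.
have [x1 x10 pE] := square_preimage rho0 p0.
have [x2 x20 qE] := square_preimage rho0 q0.
have x12 : x1 < x2.
  move: pq; rewrite pE qE ltr_pM2r ?invr_gt0// ltr_pM2l// ltr_sqr ?nnegrE ?ltW//.
exists x1, x2; split => //.
by rewrite pE qE; exact: gamma_gauss_subst.
Qed.

Lemma gauss_weight_itv_le a rho x1 x2 : 0 <= a -> 0 < rho ->
  \int[mu]_(r in `[x1, x2]) gauss_weight a rho r <= \int[mu]_r gauss_weight a rho r.
Proof.
move=> a0 rho0; have ig := integrable_gauss_weight a0 rho0.
apply: fine_le.
- by apply: integrable_fin_num => //; exact: integrableS ig.
- exact: integrable_fin_num.
apply: ge0_subset_integral => //.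
  by apply/measurable_EFinP; exact: measurable_gauss_weight.
by move=> x _; rewrite lee_fin gauss_weight_ge0.
Qed.

Lemma Gamma_approx a : 0 <= a ->
  (\int[mu]_(t in `]0%R, +oo[) (gamma_fun ((a + 1) / 2) t)%:E =
    (Gamma ((a + 1) / 2))%:E)%E /\
  forall e, 0 < e -> exists p q, [/\ 0 < p, p < q &
    Gamma ((a + 1) / 2) - e < \int[mu]_(t in `[p, q]) gamma_fun ((a + 1) / 2) t].
Proof.
move=> a0; apply: (@ge0_integral_oy_exhaustion _
  (2 * (1 / 2) `^ ((a + 1) / 2) * \int[mu]_r gauss_weight a 1 r)).
- exact: measurable_gamma_fun.
- exact: gamma_fun_ge0.
move=> p q p0 pq.
have [x1 [x2 [x10 x12 E]]] := gamma_fun_itv a0 ltr01 p0 pq.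
rewrite -[X in (X <= _)%E]fineK; last first.
  apply: integrable_fin_num => //.
  apply: continuous_compact_integrable; first exact: segment_compact.
  apply: continuous_within => x /=; rewrite in_itv/= => /andP[h1 _].
  by apply: gamma_fun_continuous; exact: lt_le_trans h1.
rewrite lee_fin [X in X <= _]E ler_wpM2l ?mulr_ge0 ?powR_ge0//.
exact: gauss_weight_itv_le.
Qed.

Lemma Gamma_gt0 a : 0 <= a -> 0 < Gamma ((a + 1) / 2).
Proof.
move=> a0; have [GE _] := Gamma_approx a0.
have := @Rintegral_itv_gt0 (gamma_fun ((a + 1) / 2)) 1 2 ltac:(by rewrite ltr1n).
move=> /(_ _)/(_ _)/lt_le_trans; apply.
- move=> x /andP[h1 _]; apply: gamma_fun_continuous; exact: lt_le_trans h1.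
- move=> x /andP[h1 _]; rewrite mulr_gt0 ?expR_gt0// powR_gt0//; exact: lt_le_trans h1.
have sub : (\int[mu]_(t in `[1%R, 2%R]) (gamma_fun ((a + 1) / 2) t)%:E <=
    (Gamma ((a + 1) / 2))%:E)%E.
  rewrite -GE; apply: ge0_subset_integral => //.
  - by apply/measurable_EFinP/measurable_funTS; exact: measurable_gamma_fun.
  - by move=> x _; rewrite lee_fin gamma_fun_ge0.
  - by move=> x /=; rewrite !in_itv/= andbT => /andP[h _]; exact: lt_le_trans h.
rewrite -lee_fin fineK// ge0_fin_numE; first exact: le_lt_trans sub (ltry _).
by apply: integral_ge0 => x _; rewrite lee_fin gamma_fun_ge0.
Qed.

(** Integral of [gauss_weight a rho] over the half-line if a > 0, and over the
    line if a = 0, in terms of the Gamma function. *)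
Definition gauss_mass a rho : R :=
  (if 0 < a then 2^-1 else 1) * (2 / rho) `^ ((a + 1) / 2) * Gamma ((a + 1) / 2).

Lemma gauss_mass_gt0 a rho : 0 <= a -> 0 < rho -> 0 < gauss_mass a rho.
Proof.
move=> a0 rho0; rewrite /gauss_mass !mulr_gt0// ?Gamma_gt0 ?powR_gt0 ?divr_gt0//.
by case: ifP => _; rewrite ?invr_gt0.
Qed.

(** When a = 0 the Gaussian lives on the whole line, and both half-lines
    contribute equally. *)
Lemma gauss_weight_sym x1 x2 rho : 0 < rho -> 0 < x1 -> x1 < x2 ->
  2 * \int[mu]_(r in `[x1, x2]) gauss_weight 0 rho r <=
  \int[mu]_(r in `[- x2, x2]) gauss_weight 0 rho r.
Proof.
move=> rho0 x10 x12.
have ig (A : set (measurableTypeR R)) : measurable A ->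
    mu.-integrable A (EFin \o gauss_weight 0 rho).
  by move=> mA; apply: integrableS (integrable_gauss_weight (lexx 0) rho0).
have opp : \int[mu]_(r in `[- x2, - x1]) gauss_weight 0 rho r =
           \int[mu]_(r in `[x1, x2]) gauss_weight 0 rho r.
  have cw : {within `[- x2, - x1], continuous (gauss_weight 0 rho)}.
    by apply: continuous_within => x _; apply: continuous_gauss_weight; left.
  rewrite /Rintegral (integration_by_substitution_oppr (ltW x12) cw).
  congr fine; apply: eq_integral => x _ /=.
  by rewrite /gauss_weight normrN sqrrN.
have disj : [disjoint `[- x2, - x1]%classic & `[x1, x2]%classic].
  apply/disj_setPS => x /=; rewrite !in_itv/= => -[/andP[_ h1] /andP[h2 _]].
  by move: h1 h2 x10; lra.
rewrite mulr2n mulrDl mul1r -{1}opp -Rintegral_setU//; last first.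
  by apply: ig; apply: measurableU.
apply: fine_le.
- by apply: integrable_fin_num => //; first exact: measurableU; apply: ig; exact: measurableU.
- by apply: integrable_fin_num => //; apply: ig.
apply: ge0_subset_integral => //.
- exact: measurableU.
- by apply/measurable_EFinP/measurable_funTS; exact: measurable_gauss_weight.
- by move=> x _; rewrite lee_fin gauss_weight_ge0.
move=> x /=; rewrite !in_itv/= => -[/andP[h1 h2]|/andP[h1 h2]]; apply/andP; split; lra.
Qed.

Lemma gauss_mass_approx a rho e : 0 <= a -> 0 < rho -> 0 < e ->
  exists t1 t2, [/\ t1 < t2, (a = 0 \/ 0 < t1) &
    gauss_mass a rho - e < \int[mu]_(t in `[t1, t2]) gauss_weight a rho t].
Proof.
move=> a0 rho0 e0.
set h := (2 / rho) `^ ((a + 1) / 2).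
have h0 : 0 < h by exact/powR_gt0/divr_gt0.
have hinv : h * (rho / 2) `^ ((a + 1) / 2) = 1.
  rewrite -powRM ?divr_ge0 ?ltW//.
  have -> : 2 / rho * (rho / 2) = 1 by field; rewrite gt_eqF.
  by rewrite powR1.
have [p [q [p0 pq]]] := (Gamma_approx a0).2 (e / h) (divr_gt0 e0 h0).
have [x1 [x2 [x10 x12 ->]]] := gamma_fun_itv a0 rho0 p0 pq.
rewrite -(ltr_pM2l h0) mulrBr (mulrCA h e) divff ?gt_eqF// mulr1.
set I := \int[mu]_(r in `[x1, x2]) _.
have -> : h * (2 * (rho / 2) `^ ((a + 1) / 2) * I) = 2 * I.
  by rewrite mulrA mulrCA hinv mulr1.
move=> hI; rewrite /gauss_mass -/h; case: ifPn => a1.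
  exists x1, x2; split => //; first by right.
  rewrite -/I; lra.
have a00 : a = 0 by apply/eqP; rewrite eq_le a0 leNgt a1.
exists (- x2), x2; split; [lra|by left|].
rewrite mul1r (lt_le_trans hI)// /I a00; exact: gauss_weight_sym.
Qed.

End gauss_mass.

(** * Integrals of bounded functions against a weight *)

Section weighted.
Context d (X : measurableType d) (R : realType) (m : {measure set X -> \bar R}).
Implicit Types (F G w : X -> R).

Definition bmeas F := measurable_fun setT F /\ exists M, forall x, `|F x| <= M.

Definition weight w :=
  [/\ measurable_fun setT w, (forall x, 0 <= w x) & m.-integrable setT (EFin \o w)].

Definition wint w F : R := \int[m]_x (F x * w x).

Lemma bmeas_cst k : bmeas (cst k).
Proof. by split; [exact: measurable_cst|exists `|k|]. Qed.

Lemma bmeasD F G : bmeas F -> bmeas G -> bmeas (fun x => F x + G x).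
Proof.
move=> [mF [M hM]] [mG [N hN]]; split; first exact: measurable_funD.
by exists (M + N) => x; rewrite (le_trans (ler_normD _ _))// lerD.
Qed.

Lemma bmeasM F G : bmeas F -> bmeas G -> bmeas (fun x => F x * G x).
Proof.
move=> [mF [M hM]] [mG [N hN]]; split; first exact: measurable_funM.
by exists (M * N) => x; rewrite normrM ler_pM.
Qed.

Lemma bmeasZ k F : bmeas F -> bmeas (fun x => k * F x).
Proof. by move=> /(bmeasM (bmeas_cst k)). Qed.

Lemma bmeas_sqr F : bmeas F -> bmeas (fun x => F x ^+ 2).
Proof. by move=> bF; have := bmeasM bF bF. Qed.

Lemma bmeas_ln F (c C : R) : 0 < c -> measurable_fun setT F ->
  (forall x, c <= F x <= C) -> bmeas (fun x => ln (F x)).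
Proof.
move=> c0 mF cFC; split.
  exact: (measurableT_comp (@measurable_ln R) mF).
exists (`|ln c| + `|ln C|) => x; have /andP[cF FC] := cFC x.
have C0 : 0 < C by exact: lt_le_trans c0 (le_trans cF FC).
have F0 := lt_le_trans c0 cF.
have h1 : ln c <= ln (F x) by rewrite ler_ln ?posrE.
have h2 : ln (F x) <= ln C by rewrite ler_ln ?posrE.
have h3 := ler_norm (ln C); have := ler_norm (- ln c); rewrite normrN => h4.
have h5 := normr_ge0 (ln c); have h6 := normr_ge0 (ln C).
by rewrite ler_norml; apply/andP; split; lra.
Qed.

Lemma bmeas_itv F (c C : R) : measurable_fun setT F ->
  (forall x, c <= F x <= C) -> bmeas F.
Proof.
move=> mF cFC; split => //; exists (`|c| + `|C|) => x; have /andP[h1 h2] := cFC x.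
have h3 := ler_norm C; have := ler_norm (- c); rewrite normrN => h4.
have h5 := normr_ge0 c; have h6 := normr_ge0 C.
by rewrite ler_norml; apply/andP; split; lra.
Qed.

Lemma wint_integrable w F : weight w -> bmeas F ->
  m.-integrable setT (EFin \o (fun x => F x * w x)).
Proof.
move=> [mw w0 iw] [mF [M hM]].
have := @integrableMr _ _ _ m _ measurableT F (EFin \o w) mF _ iw.
apply; exists M; split; first exact: num_real.
by move=> y My x _; exact: le_trans (hM x) (ltW My).
Qed.

Lemma wintD w F G : weight w -> bmeas F -> bmeas G ->
  wint w (fun x => F x + G x) = wint w F + wint w G.
Proof.
move=> ww bF bG.
rewrite /wint -(RintegralD measurableT (wint_integrable ww bF) (wint_integrable ww bG)).
by apply: eq_Rintegral => x _; rewrite mulrDl.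
Qed.

Lemma wintZ w k F : weight w -> bmeas F -> wint w (fun x => k * F x) = k * wint w F.
Proof.
move=> ww bF; rewrite /wint -(RintegralZl k measurableT (wint_integrable ww bF)).
by apply: eq_Rintegral => x _; rewrite mulrA.
Qed.

Lemma wint_ge0 w F : weight w -> (forall x, 0 <= F x) -> 0 <= wint w F.
Proof. by move=> [_ w0 _] F0; apply: Rintegral_ge0 => x _; exact: mulr_ge0. Qed.

Lemma wint_le w F G : weight w -> bmeas F -> bmeas G -> (forall x, F x <= G x) ->
  wint w F <= wint w G.
Proof.
move=> ww bF bG FG.
apply: (le_Rintegral measurableT (wint_integrable ww bF) (wint_integrable ww bG)).
by move=> x _; apply: ler_wpM2r; [have [_ w0 _] := ww; exact: w0|exact: FG].
Qed.

Lemma eq_wint w F G : F =1 G -> wint w F = wint w G.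
Proof. by move=> FG; congr wint; apply/funext. Qed.

End weighted.
Arguments bmeas {d X R}.

Section product.
Context d1 d2 (X : measurableType d1) (Y : measurableType d2) (R : realType).
Context (m1 : {sigma_finite_measure set X -> \bar R})
  (m2 : {sigma_finite_measure set Y -> \bar R}).
Context (w1 : X -> R) (w2 : Y -> R) (ww1 : weight m1 w1) (ww2 : weight m2 w2).
Implicit Types F : X * Y -> R.

Lemma bmeas_section1 F x : bmeas F -> bmeas (fun y => F (x, y)).
Proof.
move=> [mF [M hM]]; split; last by exists M.
exact: (measurableT_comp mF (measurable_pair1 x)).
Qed.

Lemma bmeas_section2 F y : bmeas F -> bmeas (fun x => F (x, y)).
Proof.
move=> [mF [M hM]]; split; last by exists M.
exact: (measurableT_comp mF (measurable_pair2 y)).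
Qed.

(** Tonelli's theorem. *)
Lemma prod_weight : weight (m1 \x m2)%E (fun z => w1 z.1 * w2 z.2).
Proof.
have [mw1 w10 iw1] := ww1; have [mw2 w20 iw2] := ww2.
have mw : measurable_fun setT (fun z : X * Y => w1 z.1 * w2 z.2).
  by apply: measurable_funM; [exact: (measurableT_comp mw1 measurable_fst)|
    exact: (measurableT_comp mw2 measurable_snd)].
split => //; first by move=> z; exact: mulr_ge0.
have mEw : measurable_fun setT (EFin \o (fun z : X * Y => w1 z.1 * w2 z.2)).
  exact/measurable_EFinP.
apply/(integrable12ltyP _ _ mEw).
have E x : (\int[m2]_y `|(w1 x * w2 y)%:E| = (w1 x * \int[m2]_y w2 y)%:E)%E.
  rewrite EFinM /Rintegral fineK; last exact: integrable_fin_num.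
  rewrite -ge0_integralZl//.
  - apply: eq_integral => y _; rewrite gee0_abs ?EFinM// lee_fin.
    exact: mulr_ge0.
  - exact/measurable_EFinP.
  - by move=> y _; rewrite lee_fin.
  - by rewrite lee_fin.
rewrite /=; under eq_integral do rewrite E EFinM muleC.
have c0 : 0 <= \int[m2]_y w2 y by apply: Rintegral_ge0.
rewrite ge0_integralZl//.
- rewrite lte_mul_pinfty//.
  have /integrableP[_] := iw1.
  by under eq_integral do rewrite gee0_abs ?lee_fin//.
- exact/measurable_EFinP.
- by move=> x _; rewrite lee_fin.
Qed.

(** Measurability of partial integrals is available for nonnegative functions,
    hence the shift of F by its bound M. *)
Lemma bmeas_partial1 F : bmeas F -> bmeas (fun x => wint m2 w2 (fun y => F (x, y))).
Proof.
move=> bF; have [mF [M hM]] := bF; have [mw2 w20 iw2] := ww2.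
split; last first.
  exists (M * \int[m2]_y w2 y) => x; rewrite /wint.
  have iF := wint_integrable ww2 (bmeas_section1 x bF).
  apply: le_trans (le_normr_Rintegral measurableT iF) _.
  rewrite -RintegralZl//; apply: le_Rintegral => //.
  - exact: (integrable_norm iF).
  - exact: integrableZl iw2.
  - by move=> y _; rewrite normrM (ger0_norm (w20 y)); apply: ler_wpM2r.
pose H z : \bar R := ((F z + M) * w2 z.2)%:E.
have H0 z : (0 <= H z)%E.
  rewrite lee_fin mulr_ge0// -lerBlDr sub0r.
  by have := hM z; rewrite ler_norml => /andP[].
have mH : measurable_fun setT H.
  apply/measurable_EFinP; apply: measurable_funM.
    exact: measurable_funD.
  exact: (measurableT_comp mw2 measurable_snd).
have mint := @measurable_fun_fubini_tonelli_F _ _ _ _ R m2 H mH H0.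
have -> : (fun x => wint m2 w2 (fun y => F (x, y))) =
    (fun x => fine (fubini_F m2 H x) - M * \int[m2]_y w2 y).
  apply/funext => x.
  have iF := wint_integrable ww2 (bmeas_section1 x bF).
  have iM := wint_integrable ww2 (bmeas_cst Y M).
  rewrite /fubini_F /H /= -(RintegralZl M measurableT iw2).
  rewrite -/(Rintegral m2 setT (fun y => (F (x, y) + M) * w2 y)).
  under eq_Rintegral do rewrite mulrDl.
  by rewrite (RintegralD measurableT iF iM) addrK.
apply: measurable_funB; last exact: measurable_cst.
exact: (measurableT_comp (@fine_measurable R setT measurableT) mint).
Qed.

Lemma wint_fubini1 F : bmeas F ->
  wint (m1 \x m2)%E (fun z => w1 z.1 * w2 z.2) F =
  wint m1 w1 (fun x => wint m2 w2 (fun y => F (x, y))).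
Proof.
move=> bF; have ii := wint_integrable prod_weight bF.
rewrite /wint [LHS]/Rintegral -(integral12_prod_meas1 ii) /Rintegral.
congr fine; apply: eq_integral => x _; rewrite /fubini_F /=.
have iF := wint_integrable ww2 (bmeas_section1 x bF).
rewrite mulrC EFinM fineK; last exact: integrable_fin_num.
rewrite -(integralZl measurableT iF).
by apply: eq_integral => y _; rewrite /= -EFinM; congr EFin; ring.
Qed.

End product.

(** * Fubini on row vectors *)

Section product_swap.
Context d1 d2 (X : measurableType d1) (Y : measurableType d2) (R : realType).
Context (m1 : {sigma_finite_measure set X -> \bar R})
  (m2 : {sigma_finite_measure set Y -> \bar R}).
Context (w1 : X -> R) (w2 : Y -> R) (ww1 : weight m1 w1) (ww2 : weight m2 w2).
Implicit Types F : X * Y -> R.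

Lemma bmeas_partial2 F : bmeas F -> bmeas (fun y => wint m1 w1 (fun x => F (x, y))).
Proof.
move=> [mF [M hM]].
apply: (@bmeas_partial1 _ _ Y X R m1 w1 ww1 (fun z => F (z.2, z.1))).
split; last by exists M => z.
apply: (measurableT_comp mF).
exact: (measurable_fun_pair measurable_snd measurable_fst).
Qed.

Lemma wint_fubini2 F : bmeas F ->
  wint (m1 \x m2)%E (fun z => w1 z.1 * w2 z.2) F =
  wint m2 w2 (fun y => wint m1 w1 (fun x => F (x, y))).
Proof.
move=> bF; have ii := wint_integrable (prod_weight ww1 ww2) bF.
rewrite /wint [LHS]/Rintegral -(integral21_prod_meas1 ii) /Rintegral.
congr fine; apply: eq_integral => y _; rewrite /fubini_G /=.
have iF := wint_integrable ww1 (bmeas_section2 y bF).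
rewrite mulrC EFinM fineK; last exact: integrable_fin_num.
rewrite -(integralZl measurableT iF).
by apply: eq_integral => x _; rewrite /= -EFinM; congr EFin; ring.
Qed.

End product_swap.

Section rV_fubini.
Context {R : realType}.
Notation mu := (@lebesgue_measure R).

Definition rV_weight n (b : 'I_n -> R -> R) (x : 'rV[R]_n) : R :=
  \prod_i b i (x ord0 i).

Lemma rV_weight_cons n (b : 'I_n.+1 -> R -> R) t (y : 'rV[R]_n) :
  rV_weight b (rV_cons (t, y)) = b ord0 t * rV_weight (fun i => b (lift ord0 i)) y.
Proof.
rewrite /rV_weight big_ord_recl mxE unlift_none; congr (_ * _).
by apply: eq_bigr => i _; rewrite mxE liftK.
Qed.

Lemma integral_rV_cons_ge0 n (G : 'rV[R]_n.+1 -> \bar R) :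
  measurable_fun setT G -> (forall x, 0 <= G x)%E ->
  (\int[lebesgue_rV n.+1]_x G x =
   \int[mu]_t \int[lebesgue_rV n]_y G (rV_cons (t, y)))%E.
Proof.
move=> mG G0.
have mc := @measurable_rV_cons R n.
(* Fixes the presentation of Lebesgue measure as an image of a product. *)
rewrite (_ : (\int[lebesgue_rV n.+1]_x G x =
   \int[pushforward (mu \x lebesgue_rV n) (@rV_cons R n)]_x G x)%E) //.
rewrite (ge0_integral_pushforward mc)// preimage_setT.
have mGc : measurable_fun setT (G \o @rV_cons R n) by exact: measurableT_comp.
have Gc0 z : (0 <= (G \o @rV_cons R n) z)%E by exact: G0.
by rewrite (fubini_tonelli1 _ mGc Gc0).
Qed.

Lemma measurable_rV_weight n (b : 'I_n -> R -> R) :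
  (forall i, measurable_fun setT (b i)) -> measurable_fun setT (rV_weight b).
Proof.
move=> mb; apply: measurable_prod => i _.
exact: (measurableT_comp (mb i) (@measurable_coor R n i)).
Qed.

Lemma integral_rV_weight n (b : 'I_n -> R -> R) :
  (forall i, weight mu (b i)) ->
  (\int[lebesgue_rV n]_x (rV_weight b x)%:E = (\prod_i \int[mu]_t b i t)%:E)%E.
Proof.
elim: n b => [|n IHn] b wb.
  have mW : measurable_fun setT (fun x : 'rV[R]_0 => (rV_weight b x)%:E).
    by apply/measurable_EFinP; apply: measurable_rV_weight => -[].
  rewrite big_ord0 /= integral_dirac; [|exact: measurableT|exact: mW].
  by rewrite diracT mul1e /rV_weight big_ord0.
have b0 (i : 'I_n.+1) t : 0 <= b i t by have [_ + _] := wb i; exact.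
rewrite integral_rV_cons_ge0; last 2 first.
- apply/measurable_EFinP; apply: measurable_rV_weight => i.
  by have [] := wb i.
- by move=> x; rewrite lee_fin prodr_ge0.
under eq_integral => t _.
  under eq_integral do rewrite rV_weight_cons EFinM.
  rewrite ge0_integralZl//; [|
    by apply/measurable_EFinP; apply: measurable_rV_weight => i; have [] := wb (lift ord0 i)|
    by move=> y _; rewrite lee_fin prodr_ge0|by rewrite lee_fin].
  rewrite IHn; last by move=> i; exact: wb.
  rewrite muleC; over.
have [m0 _ i0] := wb ord0.
rewrite ge0_integralZl//; last 3 first.
- exact/measurable_EFinP.
- by move=> t _; rewrite lee_fin.
- by rewrite lee_fin prodr_ge0// => i _; apply: Rintegral_ge0.
rewrite big_ord_recl mulrC EFinM; congr (_ * _)%E.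
by rewrite /Rintegral fineK//; exact: integrable_fin_num.
Qed.

Lemma weight_rV n (b : 'I_n -> R -> R) :
  (forall i, weight mu (b i)) -> weight (lebesgue_rV n) (rV_weight b).
Proof.
move=> wb; have mW : measurable_fun setT (rV_weight b).
  by apply: measurable_rV_weight => i; have [] := wb i.
have W0 x : 0 <= rV_weight b x.
  by apply: prodr_ge0 => i _; have [_ + _] := wb i; exact.
split => //; apply/integrableP; split; first exact/measurable_EFinP.
under eq_integral do rewrite gee0_abs ?lee_fin//.
by rewrite integral_rV_weight// ltry.
Qed.

Lemma wint_rV_cons n (b : 'I_n.+1 -> R -> R) (F : 'rV[R]_n.+1 -> R) :
  (forall i, weight mu (b i)) -> bmeas F ->
  wint (lebesgue_rV n.+1) (rV_weight b) F =
  wint (mu \x lebesgue_rV n)%E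
    (fun z => b ord0 z.1 * rV_weight (fun i => b (lift ord0 i)) z.2)
    (F \o @rV_cons R n).
Proof.
move=> wb bF; have mc := @measurable_rV_cons R n.
have iF := wint_integrable (weight_rV wb) bF.
rewrite /wint /Rintegral; congr fine.
rewrite (_ : (\int[lebesgue_rV n.+1]_x (F x * rV_weight b x)%:E =
   \int[pushforward (mu \x lebesgue_rV n) (@rV_cons R n)]_x (F x * rV_weight b x)%:E)%E) //.
have bFc : bmeas (F \o @rV_cons R n).
  have [mF [M hM]] := bF; split; last by exists M => z; exact: hM.
  exact: measurableT_comp.
have wp := prod_weight (wb ord0) (weight_rV (fun i => wb (lift ord0 i))).
have ip := wint_integrable wp bFc.
have E z : F (rV_cons z) * rV_weight b (rV_cons z) =
   (F \o @rV_cons R n) z * (b ord0 z.1 * rV_weight (fun i => b (lift ord0 i)) z.2).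
  by case: z => t y; rewrite rV_weight_cons.
rewrite (integral_pushforward mc)//.
- rewrite preimage_setT; apply: eq_integral => z _ /=; by rewrite E.
- by have /integrableP[] := iF.
- by rewrite preimage_setT; apply: eq_integrable ip => // z _ /=; rewrite -E.
Qed.

End rV_fubini.

(** * Continuous and differentiable functions on row vectors *)

Section rV_topology.
Context {R : realType}.

(** The topology of row vectors is the product topology. *)
Lemma cvg_rV (T : Type) (F : set_system T) (FF : Filter F) n
  (h : T -> 'rV[R]_n) (l : 'rV[R]_n) :
  (forall i, h x ord0 i @[x --> F] --> l ord0 i) -> h x @[x --> F] --> l.
Proof.
move=> hl A [P lP PA].
have : \forall x \near F, forall i j, P i j (h x i j).
  apply: filter_forall => i; apply: filter_forall => j.
  by rewrite (ord1 i); apply: hl; have := lP ord0 j.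
by apply: filterS => x Px; exact: PA.
Qed.

Lemma rV_cons_continuous1 n (y : 'rV[R]_n) : continuous (fun t : R => rV_cons (t, y)).
Proof.
move=> t; apply: cvg_rV => i; rewrite mxE.
under eq_fun do rewrite mxE.
by case: unliftP => [j|] _ /=; [exact: cvg_cst|exact: cvg_id].
Qed.

Lemma rV_cons_continuous2 n (t : R) : continuous (fun y : 'rV[R]_n => rV_cons (t, y)).
Proof.
move=> y; apply: (@cvg_rV _ (nbhs y) (nbhs_filter y)) => i; rewrite mxE.
under eq_fun do rewrite mxE.
by case: unliftP => [j|] _ /=; [exact: coord_continuous|exact: cvg_cst].
Qed.

Lemma floor_approx_cvg (t : R) :
  (Num.floor (t * k.+1%:R))%:~R / k.+1%:R @[k --> \oo] --> t.
Proof.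
have h0 : t - k.+1%:R^-1 @[k --> \oo] --> t.
  rewrite -[X in _ --> X](subr0 t); apply: cvgB; first exact: cvg_cst.
  exact: cvg_harmonic.
apply: (squeeze_cvgr _ h0 (cvg_cst t)).
apply: nearW => k; have k0 : (0 : R) < k.+1%:R by [].
have /andP[h1 h2] := floor_itv (t * k.+1%:R).
apply/andP; split; last by rewrite ler_pdivrMr.
rewrite ler_pdivlMr// mulrBl mulVf ?gt_eqF// lerBlDr.
by move: h2; rewrite intrD => /ltW.
Qed.

(** The measurable sets are generated by the coordinates, so the Borel property
    needs an argument: f is the limit of its compositions with the
    discretization of the coordinates to multiples of 1/(k+1), and these take
    countably many values. *)
Lemma continuous_measurable_rV n (f : 'rV[R]_n -> R) :
  continuous f -> measurable_fun setT f.
Proof.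
move=> cf.
pose fl k (x : 'rV[R]_n) : 'rV[int]_n := \row_i Num.floor (x ord0 i * k.+1%:R).
pose st k (z : 'rV[int]_n) : 'rV[R]_n := \row_i ((z ord0 i)%:~R / k.+1%:R).
apply: (@measurable_fun_cvg _ _ _ _ (fun k x => f (st k (fl k x)))); last first.
  move=> x _; apply: cvg_comp; last exact: cf.
  apply: cvg_rV => i; under eq_fun do rewrite !mxE.
  exact: floor_approx_cvg.
move=> k _ Y mY; rewrite setTI.
have mz z : measurable (fl k @^-1` [set z]).
  have -> : fl k @^-1` [set z] = \bigcap_(i in [set: 'I_n])
     ((fun x : 'rV[R]_n => x ord0 i : measurableTypeR R) @^-1`
        [set t : measurableTypeR R | Num.floor (t * k.+1%:R) = z ord0 i]).
    apply/seteqP; split=> x /=.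
      by move=> <- i _ /=; rewrite mxE.
    by move=> h; apply/rowP => i; rewrite mxE; exact: h.
  apply: fin_bigcap_measurable => // i _.
  rewrite -[X in measurable X]setTI; apply: measurable_coor => //.
  have -> : [set t : measurableTypeR R | Num.floor (t * k.+1%:R) = z ord0 i] =
      `[(z ord0 i)%:~R / k.+1%:R, (z ord0 i + 1)%:~R / k.+1%:R[%classic.
    apply/seteqP; split=> t /=; rewrite in_itv/= ler_pdivrMr// ltr_pdivlMr//.
      by move=> <-; exact: floor_itv.
    by move=> h; apply/eqP; rewrite floor_eq.
  exact: measurable_itv.
have -> : (fun x => f (st k (fl k x))) @^-1` Y =
    \bigcup_(z : 'rV[int]_n) (if f (st k z) \in Y then fl k @^-1` [set z] else set0).
  apply/seteqP; split=> x /=.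
    by move=> Yx; exists (fl k x) => //; rewrite mem_set.
  by move=> [z _]; case: ifPn => // /[!inE] Yz /= ->.
by apply: countable_bigcupT_measurable; [exact: countableP|move=> z; case: ifP].
Qed.

(** A directional derivative only depends on the restriction to a line. *)
Lemma is_derive_slice (V W : normedModType R) (f : V -> R) (g : W -> R) x v y w (l : R) :
  (forall h : R, g (h *: w + y) = f (h *: v + x)) -> is_derive x v f l -> is_derive y w g l.
Proof.
move=> fg [dfx dfl].
have fg0 : g y = f x by have := fg 0; rewrite !scale0r !add0r.
have E : (fun h : R => h^-1 *: (g (h *: w + y) - g y)) =
         (fun h : R => h^-1 *: (f (h *: v + x) - f x)).
  by apply/funext => h; rewrite fg fg0.
apply: DeriveDef; first by rewrite /derivable E.
by rewrite /derive E.
Qed.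

(** Bounded functions with continuous and bounded partial derivatives.  The
    partial derivatives are carried along, which makes the class visibly stable
    under freezing coordinates. *)
Definition C1b n (f : 'rV[R]_n -> R) (df : 'I_n -> 'rV[R]_n -> R) :=
  [/\ continuous f, (exists M, forall x, `|f x| <= M) &
    forall i, [/\ forall x, is_derive x (delta_mx ord0 i) f (df i x),
                  continuous (df i) & exists M, forall x, `|df i x| <= M]].

Lemma rV_cons_deriv1 n (h t : R) (y : 'rV[R]_n) :
  rV_cons (h *: (1 : R) + t, y) = h *: delta_mx ord0 ord0 + rV_cons (t, y).
Proof.
apply/rowP => i; rewrite !mxE /= /GRing.scale/=.
by case: unliftP => [j|] ->; rewrite ?eq_liftF/= ?mulr0 ?add0r.
Qed.

Lemma rV_cons_deriv2 n (h t : R) (y : 'rV[R]_n) (j : 'I_n) :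
  rV_cons (t, h *: delta_mx ord0 j + y) = h *: delta_mx ord0 (lift ord0 j) + rV_cons (t, y).
Proof.
apply/rowP => i; rewrite !mxE /=.
case: unliftP => [k|] ->; rewrite ?mxE ?eqxx/=.
  by rewrite (inj_eq lift_inj).
by rewrite mulr0 add0r.
Qed.

Lemma C1b_slice1 n (f : 'rV[R]_n.+1 -> R) df (y : 'rV[R]_n) : C1b f df ->
  [/\ forall t : R, is_derive t (1 : R) (fun t : R => f (rV_cons (t, y)))
        (df ord0 (rV_cons (t, y))),
      continuous (fun t : R => df ord0 (rV_cons (t, y))),
      exists M, forall t : R, `|f (rV_cons (t, y))| <= M &
      exists M, forall t : R, `|df ord0 (rV_cons (t, y))| <= M].
Proof.
move=> [cf [M fM] /(_ ord0)[ddf cdf [N dfN]]]; split.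
- move=> t; apply: is_derive_slice (ddf _) => h.
  by rewrite rV_cons_deriv1.
- move=> t; apply: (@continuous_comp _ _ _ (fun t : R => rV_cons (t, y))); last exact: cdf.
  exact: rV_cons_continuous1.
- by exists M.
- by exists N.
Qed.

Lemma C1b_slice2 n (f : 'rV[R]_n.+1 -> R) df (t : R) : C1b f df ->
  C1b (fun y : 'rV[R]_n => f (rV_cons (t, y)))
      (fun i y => df (lift ord0 i) (rV_cons (t, y))).
Proof.
move=> [cf [M fM] Hf].
have cc (g : 'rV[R]_n.+1 -> R) : continuous g ->
    continuous (fun y : 'rV[R]_n => g (rV_cons (t, y))).
  move=> cg y; apply: (@continuous_comp _ _ _ (fun y : 'rV[R]_n => rV_cons (t, y))).
    exact: rV_cons_continuous2.
  exact: cg.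
split; [exact: cc|by exists M|].
move=> i; have [ddf cdf [N dfN]] := Hf (lift ord0 i); split.
- by move=> y; apply: is_derive_slice (ddf _) => h; rewrite rV_cons_deriv2.
- exact: cc.
- by exists N.
Qed.

Lemma C1b_bmeas n (f : 'rV[R]_n -> R) df : C1b f df -> bmeas f /\ forall i, bmeas (df i).
Proof.
move=> [cf bf Hf]; split.
  by split => //; exact: continuous_measurable_rV.
move=> i; have [_ cdf bdf] := Hf i; split => //; exact: continuous_measurable_rV.
Qed.

End rV_topology.

(** * Tensorization of the dual logarithmic Sobolev inequality *)

Section tensor.
Context {R : realType}.
Notation mu := (@lebesgue_measure R).

(** The dual logarithmic Sobolev inequality for the measure b(t) dt and for
    functions that vanish on P, the set of end points at which the boundary term
    has to vanish. *)
Definition dual_log_sobolev1 (b : R -> R) (P : set R) (kappa k : R) : Prop :=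
  forall (f f' U : R -> R) (c C : R),
  (forall t, is_derive t (1 : R) f (f' t)) -> continuous f' ->
  (exists M, forall t, `|f t| <= M) -> (exists M, forall t, `|f' t| <= M) ->
  (forall t, P t -> f t = 0) ->
  measurable_fun setT U -> 0 < c -> (forall t, c <= U t <= C) ->
  wint mu b (fun t => f t ^+ 2 * ln (U t)) <=
  kappa * wint mu b (fun t => f' t ^+ 2) - k * wint mu b (fun t => f t ^+ 2)
  + wint mu b (fun t => f t ^+ 2) * ln (wint mu b U).

Notation wintn n b := (wint (lebesgue_rV n) (rV_weight b)).

Lemma wint_rV0 (b : 'I_0 -> R -> R) (F : 'rV[R]_0 -> R) : wintn 0 b F = F 0.
Proof.
have E x : F x * rV_weight b x = F 0.
  by rewrite /rV_weight big_ord0 mulr1; congr F; apply/rowP => -[].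
rewrite /wint /Rintegral; under eq_integral do rewrite E.
rewrite integral_dirac; [|exact: measurableT|exact: measurable_cst].
by rewrite diracT mul1e.
Qed.

(** For fixed y, the inequality in the first variable t brings out
    U2 y, the integral of U (t, y) in t.  For fixed t, the induction hypothesis
    applied to U2 in the place of U handles the remaining term
    f^2 (t, y) ln (U2 y), and the integral of U2 is that of U. *)
Lemma dual_log_sobolev_tensor (kappa : R) n (b : 'I_n -> R -> R) (P : 'I_n -> set R)
  (k : 'I_n -> R) :
  (forall i, weight mu (b i)) -> (forall i, 0 < wint mu (b i) (cst 1)) ->
  (forall i, dual_log_sobolev1 (b i) (P i) kappa (k i)) ->
  forall (f : 'rV[R]_n -> R) df (U : 'rV[R]_n -> R) (c C : R), C1b f df ->
  (forall (x : 'rV[R]_n) i, P i (x ord0 i) -> f x = 0) ->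
  measurable_fun setT U -> 0 < c -> (forall x, c <= U x <= C) ->
  wintn n b (fun x => f x ^+ 2 * ln (U x)) <=
  kappa * wintn n b (fun x => \sum_i df i x ^+ 2)
  - (\sum_i k i) * wintn n b (fun x => f x ^+ 2)
  + wintn n b (fun x => f x ^+ 2) * ln (wintn n b U).
Proof.
elim: n b P k => [|n IHn] b P k wb b1 LS f df U c C Cf fP mU c0 cUC.
  by rewrite !wint_rV0 !big_ord0 mulr0 mul0r subr0 add0r.
set b' := fun i => b (lift ord0 i).
have wb' i : weight mu (b' i) by exact: wb.
have ww' := weight_rV wb'.
have ww0 := wb ord0.
set W' := wintn n b'; set J := wint mu (b ord0); set W := wintn n.+1 b.
have bcons (F : 'rV[R]_n.+1 -> R) : bmeas F -> bmeas (F \o @rV_cons R n).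
  move=> [mF [M hM]]; split; last by exists M => z; exact: hM.
  exact: (measurableT_comp mF (@measurable_rV_cons R n)).
have WJ (F : 'rV[R]_n.+1 -> R) : bmeas F -> W F = J (fun t => W' (fun y => F (rV_cons (t, y)))).
  by move=> bF; rewrite /W wint_rV_cons// (wint_fubini1 ww0 ww' (bcons _ bF)).
have WW' (F : 'rV[R]_n.+1 -> R) : bmeas F -> W F = W' (fun y => J (fun t => F (rV_cons (t, y)))).
  by move=> bF; rewrite /W wint_rV_cons// (wint_fubini2 ww0 ww' (bcons _ bF)).
have bJ (F : 'rV[R]_n.+1 -> R) : bmeas F -> bmeas (fun y => J (fun t => F (rV_cons (t, y)))).
  by move=> bF; exact: (bmeas_partial2 ww0 (bcons _ bF)).
have bW' (F : 'rV[R]_n.+1 -> R) : bmeas F -> bmeas (fun t => W' (fun y => F (rV_cons (t, y)))).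
  by move=> bF; exact: (bmeas_partial1 ww' (bcons _ bF)).
have bS1 (F : 'rV[R]_n.+1 -> R) y : bmeas F -> bmeas (fun t => F (rV_cons (t, y))).
  by move=> bF; exact: (bmeas_section2 y (bcons _ bF)).
have bS2 (F : 'rV[R]_n.+1 -> R) t : bmeas F -> bmeas (fun y => F (rV_cons (t, y))).
  by move=> bF; exact: (bmeas_section1 t (bcons _ bF)).
have [bf bdf] := C1b_bmeas Cf.
have bf2 := bmeas_sqr bf.
have blnU := bmeas_ln c0 mU cUC.
have bU := bmeas_itv mU cUC.
have bfU := bmeasM bf2 blnU.
have bd0 := bmeas_sqr (bdf ord0).
pose S x := \sum_i df (lift ord0 i) x ^+ 2.
have bS : bmeas S.
  rewrite /S; elim: (index_enum _) => [|i s IHs].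
    by under eq_fun do rewrite big_nil; exact: bmeas_cst.
  by under eq_fun do rewrite big_cons; apply: bmeasD => //; exact/bmeas_sqr/bdf.
pose U2 y := J (fun t => U (rV_cons (t, y))).
have bU2 : bmeas U2 by exact: bJ.
have mU2 : measurable_fun setT U2 by have [] := bU2.
set j1 := wint mu (b ord0) (cst 1).
have U2b y : c * j1 <= U2 y <= C * j1.
  have bc : bmeas (fun t : R => c * cst 1 t) by exact/bmeasZ/bmeas_cst.
  have bC : bmeas (fun t : R => C * cst 1 t) by exact/bmeasZ/bmeas_cst.
  have ba : bmeas (cst 1 : R -> R) := bmeas_cst _ _.
  rewrite -!(wintZ _ ww0 ba); apply/andP; split; apply: wint_le => //; try exact: bS1.
    by move=> t; rewrite mulr1; have /andP[] := cUC (rV_cons (t, y)).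
  by move=> t; rewrite mulr1; have /andP[] := cUC (rV_cons (t, y)).
have cj0 : 0 < c * j1 by exact: mulr_gt0 c0 (b1 ord0).
have blnU2 := bmeas_ln cj0 mU2 U2b.
pose J2 y := J (fun t => f (rV_cons (t, y)) ^+ 2).
have bJ2 : bmeas J2 by exact: (bJ _ bf2).
have step1 : W (fun x => f x ^+ 2 * ln (U x)) <=
    kappa * W (fun x => df ord0 x ^+ 2) - k ord0 * W (fun x => f x ^+ 2)
    + W' (fun y => J2 y * ln (U2 y)).
  have bA := bmeasZ kappa (bJ _ bd0).
  have bB := bmeasZ (- k ord0) bJ2.
  have bC := bmeasM bJ2 blnU2.
  rewrite -mulNr (WW' _ bfU) (WW' _ bd0) (WW' _ bf2).
  rewrite -(wintZ _ ww' (bJ _ bd0)) -(wintZ _ ww' bJ2) -(wintD ww' bA bB).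
  rewrite -(wintD ww' (bmeasD bA bB) bC).
  apply: (wint_le ww' (bJ _ bfU) (bmeasD (bmeasD bA bB) bC)).
  move=> y; have [h1 h2 h3 h4] := C1b_slice1 y Cf.
  have := LS ord0 (fun t => f (rV_cons (t, y))) (fun t => df ord0 (rV_cons (t, y)))
    (fun t => U (rV_cons (t, y))) c C h1 h2 h3 h4.
  rewrite mulNr; apply => //.
  - by move=> t Pt; apply: (fP _ ord0); rewrite mxE unlift_none.
  - by have [] := bS1 _ y bU.
pose G z := f (rV_cons z) ^+ 2 * ln (U2 z.2).
have bG : bmeas G.
  apply: bmeasM; first exact: (bcons _ bf2).
  have [m1 [M hM]] := blnU2; split; last by exists M => z; exact: hM.
  exact: (measurableT_comp m1 measurable_snd).
have GE : W' (fun y => J2 y * ln (U2 y)) =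
    J (fun t => W' (fun y => f (rV_cons (t, y)) ^+ 2 * ln (U2 y))).
  transitivity (wint (mu \x lebesgue_rV n)%E
    (fun z => b ord0 z.1 * rV_weight b' z.2) G).
    rewrite (wint_fubini2 ww0 ww' bG); apply: eq_wint => y.
    rewrite /G /= /J2 mulrC -(wintZ _ ww0); last exact: (bS1 _ y bf2).
    by apply: eq_wint => t; rewrite mulrC.
  by rewrite (wint_fubini1 ww0 ww' bG).
have WU2 : W' U2 = W U by rewrite WW'.
have step2 : W' (fun y => J2 y * ln (U2 y)) <=
    kappa * W S - (\sum_i k (lift ord0 i)) * W (fun x => f x ^+ 2)
    + ln (W U) * W (fun x => f x ^+ 2).
  have bA := bmeasZ kappa (bW' _ bS).
  have bB := bmeasZ (- (\sum_i k (lift ord0 i))) (bW' _ bf2).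
  have bC := bmeasZ (ln (W U)) (bW' _ bf2).
  rewrite GE -mulNr (WJ _ bS) (WJ _ bf2).
  rewrite -(wintZ _ ww0 (bW' _ bS)) -!(wintZ _ ww0 (bW' _ bf2)) -(wintD ww0 bA bB).
  rewrite -(wintD ww0 (bmeasD bA bB) bC).
  apply: (wint_le ww0 (bmeas_partial1 ww' bG) (bmeasD (bmeasD bA bB) bC)).
  move=> t; rewrite mulNr -WU2 [ln _ * _]mulrC.
  apply: (IHn b' (fun i => P (lift ord0 i)) (fun i => k (lift ord0 i)) wb' _ _
    _ _ U2 (c * j1) (C * j1) (C1b_slice2 t Cf)) => //.
  - by move=> i; exact: b1.
  - by move=> i; exact: LS.
  - by move=> y i Pi; apply: (fP _ (lift ord0 i)); rewrite mxE liftK.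
have -> : W (fun x => \sum_i df i x ^+ 2) = W (fun x => df ord0 x ^+ 2) + W S.
  rewrite -(wintD (weight_rV wb))//; apply: eq_wint => x.
  by rewrite big_ord_recl.
rewrite big_ord_recl; move: step1 step2; lra.
Qed.

End tensor.

(** * Monomial weights truncated to a box *)

Section boxes.
Context {R : realType}.
Notation mu := (@lebesgue_measure R).
Implicit Types (a rho x : R).

Definition pow_weight a x1 x2 : R -> R := (fun t => `|t| `^ a) \_ `[x1, x2].

Lemma wint_pow_weight a x1 x2 F : wint mu (pow_weight a x1 x2) F = pow_integral a x1 x2 F.
Proof.
rewrite /wint /pow_integral [RHS]Rintegral_mkcond; apply: eq_Rintegral => t _.
by rewrite /pow_weight !patchE; case: ifP => //; rewrite mulr0.
Qed.

Lemma pow_weight_ge0 a x1 x2 t : 0 <= pow_weight a x1 x2 t.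
Proof. by rewrite /pow_weight patchE; case: ifP => // _; rewrite powR_ge0. Qed.

Lemma weight_pow a x1 x2 : (a = 0 \/ 0 < x1) -> weight mu (pow_weight a x1 x2).
Proof.
move=> ax; split.
- apply/(measurable_restrictT (fun t : R => `|t| `^ a)) => //.
  exact: (measurable_funTS (measurable_absr_powR a)).
- exact: pow_weight_ge0.
- rewrite /pow_weight -restrict_EFin; apply/integrable_restrict => //.
  rewrite setTI.
  apply: continuous_compact_integrable; first exact: segment_compact.
  apply: continuous_within => x /=; rewrite in_itv/= => /andP[h1 _].
  by apply: continuous_absr_powR; case: ax => [->|x0]; [left|right; exact: lt_le_trans h1].
Qed.

Lemma wint_pow_weight_gt0 a x1 x2 : (a = 0 \/ 0 < x1) -> x1 < x2 ->
  0 < wint mu (pow_weight a x1 x2) (cst 1).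
Proof.
move=> ax x12; rewrite wint_pow_weight /pow_integral.
under eq_Rintegral do rewrite mul1r.
have ax' x : x1 <= x <= x2 -> a = 0 \/ 0 < x.
  by move=> /andP[h1 _]; case: ax => [->|x0]; [left|right; exact: lt_le_trans h1].
apply: Rintegral_itv_gt0 => // x /ax'; [exact: continuous_absr_powR|exact: absr_powR_gt0].
Qed.

(** The truncated Gaussian masses have supremum [gauss_mass a rho], and the
    inequality is continuous in the mass. *)
Lemma dual_log_sobolev_pow a rho x1 x2 : 0 <= a -> 0 < rho -> x1 < x2 ->
  (a = 0 \/ 0 < x1) ->
  dual_log_sobolev1 (pow_weight a x1 x2) [set t | t = x2 \/ a = 0 /\ t = x1]
    (2 / rho) (1 + a + ln (gauss_mass a rho)).
Proof.
move=> a0 rho0 x12 ax f f' U c C df cf' _ _ fP mU c0 cUC.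
rewrite !wint_pow_weight; set m := pow_integral a x1 x2 (fun t => f t ^+ 2).
have m0 : 0 <= m.
  by apply: Rintegral_ge0 => x _; exact: mulr_ge0 (sqr_ge0 _) (powR_ge0 _ _).
have Z0 := gauss_mass_gt0 a0 rho0; set Z := gauss_mass a rho in Z0 *.
apply/ler_addgt0Pr => e e0.
(* A target of mass at least Z exp(- eta) costs eta m in the inequality. *)
pose eta := e / (m + 1).
have m1 : 0 < m + 1 by rewrite ltr_wpDl.
have eta0 : 0 < eta by rewrite divr_gt0.
have e1 : 0 < Z * (1 - expR (- eta)).
  by rewrite mulr_gt0// subr_gt0 -expR0 ltr_expR oppr_lt0.
have [t1 [t2 [t12 at1 Zt]]] := gauss_mass_approx a0 rho0 e1.
have Ze : Z - Z * (1 - expR (- eta)) = Z * expR (- eta) by ring.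
rewrite -/Z Ze in Zt.
have lnZ : ln Z - eta <= ln (\int[mu]_(t in `[t1, t2]) gauss_weight a rho t).
  have Ze0 := mulr_gt0 Z0 (expR_gt0 (- eta)).
  have I0 := lt_trans Ze0 Zt.
  by rewrite -[X in ln Z + X]expRK -lnM ?posrE ?expR_gt0// ler_ln ?posrE// ltW.
have ax12 : a = 0 \/ 0 < x1 /\ 0 < t1.
  by case: ax => [?|?]; [left|case: at1 => [?|?]; [left|right]].
have := dual_log_sobolev_interval a0 rho0 x12 t12 ax12 df cf' (fP _ (or_introl erefl))
  (fun h : a = 0 => fP _ (or_intror (conj h erefl))) mU c0 cUC.
rewrite -/m => /le_trans; apply.
have : m * (ln Z - eta) <= m * ln (\int[mu]_(t in `[t1, t2]) gauss_weight a rho t).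
  exact: ler_wpM2l.
have : m * eta <= e.
  by rewrite /eta mulrCA ler_piMr ?(ltW e0)// ler_pdivrMr// mul1r lerDl.
lra.
Qed.

Lemma ln_prod (I : finType) (F : I -> R) : (forall i, 0 < F i) ->
  ln (\prod_i F i) = \sum_i ln (F i).
Proof.
move=> F0; apply: (proj2 (_ : 0 < \prod_i F i /\ _)).
apply: (@big_ind2 R R (fun x y => 0 < x /\ ln x = y)).
- by rewrite ln1.
- by move=> x1 _ y1 _ [x0 <-] [y0 <-]; rewrite mulr_gt0// lnM ?posrE.
- by move=> i _; split.
Qed.

Context (n : nat) (A : 'rV[R]_n) (hn : (1 <= n)%N) (hA : forall i, 0 <= A ord0 i).

Lemma homdim_gt0 : 0 < homdim A.
Proof. by rewrite /homdim ltr_wpDr ?sumr_ge0// ltr0n. Qed.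

Lemma PiA_gt0 : 0 < PiA A.
Proof.
rewrite /PiA powR_gt0// mulr_gt0 ?invr_gt0 ?exprn_gt0//.
by apply: prodr_gt0 => i _; exact: Gamma_gt0.
Qed.

(** The right-hand side is D + ln Z, where Z = (2 Pi(A) / rho)^(D/2) is the
    integral of exp(- rho |x|^2 / 2) x^A over the orthant. *)
Lemma sum_ln_gauss_mass rho : 0 < rho ->
  \sum_i (1 + A ord0 i + ln (gauss_mass (A ord0 i) rho)) =
  homdim A + homdim A / 2 * (ln 2 - ln rho + ln (PiA A)).
Proof.
move=> rho0; set D := homdim A; have D0 := homdim_gt0.
have S1 : \sum_i (1 + A ord0 i) = D.
  by rewrite big_split/= sumr_const card_ord.
rewrite big_split/= S1; congr (_ + _).
have r0 : 0 < 2 / rho by rewrite divr_gt0.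
have E i : ln (gauss_mass (A ord0 i) rho) =
   - (if 0 < A ord0 i then ln 2 else 0) + ln (Gamma ((A ord0 i + 1) / 2)) +
   (1 + A ord0 i) / 2 * (ln 2 - ln rho).
  have h0 : 0 < (if 0 < A ord0 i then 2^-1 else 1 : R) by case: ifP; rewrite ?invr_gt0.
  have G0 := Gamma_gt0 (hA i).
  have p0 : 0 < (2 / rho) `^ ((A ord0 i + 1) / 2) by rewrite powR_gt0.
  rewrite /gauss_mass lnM ?posrE ?mulr_gt0// lnM ?posrE// ln_powR ln_div ?posrE//.
  have -> : ln (if 0 < A ord0 i then 2^-1 else 1 : R) = - (if 0 < A ord0 i then ln 2 else 0) :> R.
    by case: ifP => _; rewrite ?lnV ?posrE// ln1 oppr0.
  by rewrite [1 + _]addrC; ring.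
rewrite (eq_bigr _ (fun i _ => E i)) !big_split/= sumrN -!mulr_suml S1.
have lnP : ln (PiA A) = 2 / D * (- (\sum_i (if 0 < A ord0 i then ln 2 else 0))
     + \sum_i ln (Gamma ((A ord0 i + 1) / 2))).
  rewrite /PiA ln_powR -/D lnM ?posrE; last 2 first.
  - by rewrite invr_gt0 exprn_gt0.
  - by apply: prodr_gt0 => i _; exact: Gamma_gt0.
  congr (_ * (_ + _)).
    rewrite lnV ?posrE ?exprn_gt0// lnXn//; congr (- _).
    by rewrite -big_mkcond/= sumr_const.
  by apply: ln_prod => i; exact: Gamma_gt0.
rewrite lnP; field; rewrite gt_eqF//.
Qed.

End boxes.

(** * Nash inequality on a box *)

Section nash.
Context {R : realType}.
Notation mu := (@lebesgue_measure R).

(** The optimal choice is rho = 4 E / (m D). *)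
Lemma nash_optimization (D p E N m : R) : 0 < D -> 0 < p -> 0 < E -> 0 < N -> 0 < m ->
  (forall rho, 0 < rho -> 2 * m * ln (m / N) <= 2 / rho * E
     - (D + D / 2 * (ln 2 - ln rho + ln p)) * m + m * ln m) ->
  m `^ (1 + 2 / D) <= 2 / (p * expR 1 * D) * E * N `^ (4 / D).
Proof.
move=> D0 p0 E0 N0 m0 h.
have e0 : 0 < expR 1 :> R by exact: expR_gt0.
have mD : 0 < m * D by rewrite mulr_gt0.
have E4 : 0 < 4 * E by rewrite mulr_gt0.
have rho0 : 0 < 4 * E / (m * D) by rewrite divr_gt0.
have pe : 0 < p * expR 1 by rewrite mulr_gt0.
have peD : 0 < p * expR 1 * D by rewrite mulr_gt0.
have c0 : 0 < 2 / (p * expR 1 * D) by rewrite divr_gt0.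
have cE : 0 < 2 / (p * expR 1 * D) * E by rewrite mulr_gt0.
have Np : 0 < N `^ (4 / D) by rewrite powR_gt0.
rewrite -ler_ln ?posrE ?powR_gt0//; last by rewrite mulr_gt0.
rewrite ln_powR lnM ?posrE// lnM ?posrE// ln_powR ln_div ?posrE// lnM ?posrE// lnM ?posrE// expRK.
have := h _ rho0.
have -> : 2 / (4 * E / (m * D)) * E = m * (D / 2) by field; rewrite !gt_eqF.
have ln4 : ln 4 = 2 * ln 2 :> R.
  have -> : 4 = 2 ^+ 2 :> R by rewrite expr2 -natrM.
  by rewrite lnXn// mulr_natl.
rewrite !ln_div ?posrE// !lnM ?posrE// ln4 => h1.
have md : 0 < m^-1 * (2 / D) by rewrite mulr_gt0 ?invr_gt0// divr_gt0.
rewrite -(ler_pM2l md) in h1.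
set lm := ln m in h1 *; set lN := ln N in h1 *; set lE := ln E in h1 *.
set lD := ln D in h1 *; set l2 := ln 2 in h1 *; set lp := ln p in h1 *.
have e1 : m^-1 * (2 / D) * (2 * m * (lm - lN)) = 4 / D * lm - 4 / D * lN.
  by field; rewrite !gt_eqF.
have e2 : m^-1 * (2 / D) * (m * (D / 2) -
   (D + D / 2 * (l2 - (2 * l2 + lE - (lm + lD)) + lp)) * m + m * lm) =
   1 - 2 - (lm + lD + lp - l2 - lE) + 2 / D * lm.
  by field; rewrite !gt_eqF.
rewrite e1 e2 in h1.
have e3 : 4 / D * lm = 2 / D * lm + 2 / D * lm by field; rewrite gt_eqF.
rewrite e3 in h1; rewrite mulrDl mul1r; lra.
Qed.

Context (n : nat) (A : 'rV[R]_n) (hn : (1 <= n)%N) (hA : forall i, 0 <= A ord0 i).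

(** Factors of the weight x^A restricted to the box of the points with
    delta <= x_i <= L if A_i > 0, and - L <= x_i <= L if A_i = 0. *)
Definition box_weight (delta L : R) (i : 'I_n) : R -> R :=
  pow_weight (A ord0 i) (if 0 < A ord0 i then delta else - L) L.

Notation W delta L := (wint (lebesgue_rV n) (rV_weight (box_weight delta L))).

Lemma box_side (delta L : R) i : 0 < delta ->
  A ord0 i = 0 \/ 0 < (if 0 < A ord0 i then delta else - L).
Proof.
move=> d0; case: ifPn => Ai; [by right|left].
by apply/eqP; rewrite eq_le hA andbT leNgt.
Qed.

Lemma weight_box (delta L : R) i : 0 < delta -> weight mu (box_weight delta L i).
Proof. by move=> d0; apply: weight_pow; exact: box_side. Qed.

Lemma dual_log_sobolev_box (delta L rho c C : R) (f : 'rV[R]_n -> R) df (U : 'rV[R]_n -> R) :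
  0 < delta -> delta < L -> 0 < rho -> C1b f df ->
  (forall x i, f x != 0 -> `|x ord0 i| < L) ->
  measurable_fun setT U -> 0 < c -> (forall x, c <= U x <= C) ->
  W delta L (fun x => f x ^+ 2 * ln (U x)) <=
  2 / rho * W delta L (fun x => \sum_i df i x ^+ 2)
  - (homdim A + homdim A / 2 * (ln 2 - ln rho + ln (PiA A))) * W delta L (fun x => f x ^+ 2)
  + W delta L (fun x => f x ^+ 2) * ln (W delta L U).
Proof.
move=> d0 dL rho0 Cf fL mU c0 cUC; rewrite -(sum_ln_gauss_mass hn hA rho0).
have x12 i : (if 0 < A ord0 i then delta else - L) < L.
  by case: ifP => // _; rewrite gtrN// (lt_trans d0).
apply: (dual_log_sobolev_tensor _ _ (fun i => dual_log_sobolev_pow (hA i) rho0 (x12 i)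
   (@box_side delta L i d0)) Cf _ mU c0 cUC).
- by move=> i; exact: weight_box.
- by move=> i; apply: wint_pow_weight_gt0 => //; exact: box_side.
- have L0 := lt_trans d0 dL.
  move=> x i Pi; apply/eqP; apply: contraTT isT => /(fL _ i).
  case: Pi => [->|[Ai0 ->]]; first by rewrite gtr0_norm// ltxx.
  by rewrite Ai0 ltxx normrN gtr0_norm// ltxx.
Qed.

(** Jensen's inequality is used in the linearized form
    y^2 ln y^2 >= 2 y^2 ln s + 2 y^2 - 2 s y with s = m / N, which is exact
    where y = s. *)
Lemma nash_box (delta L E N : R) (f : 'rV[R]_n -> R) df :
  0 < delta -> delta < L -> 0 < E -> 0 < N -> C1b f df ->
  (forall x i, f x != 0 -> `|x ord0 i| < L) ->
  W delta L (fun x => \sum_i df i x ^+ 2) <= E ->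
  W delta L (fun x => `|f x|) <= N ->
  0 < W delta L (fun x => f x ^+ 2) ->
  W delta L (fun x => f x ^+ 2) `^ (1 + 2 / homdim A) <=
  2 / (PiA A * expR 1 * homdim A) * E * N `^ (4 / homdim A).
Proof.
move=> d0 dL E0 N0 Cf fL WE WN; set m := W _ _ (fun x => f x ^+ 2) => m0.
have D0 := homdim_gt0 hn hA; have P0 := PiA_gt0 hA.
apply: nash_optimization => // rho rho0.
have ww := weight_rV (fun i => @weight_box delta L i d0).
have [bf bdf] := C1b_bmeas Cf.
have bf2 := bmeas_sqr bf.
have [mf [M fM]] := bf.
have M0 : 0 <= M := le_trans (normr_ge0 _) (fM 0).
have babs : bmeas (fun x => `|f x|).
  split; first exact: (measurableT_comp (@normr_measurable R setT) mf).
  by exists M => x; rewrite normr_id.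
set V := W delta L (cst 1).
have V0 : 0 <= V by apply: (wint_ge0 ww).
apply/ler_addgt0Pr => e e0.
(* U = f^2 + eps is bounded below; eps is small enough for its mass to be harmless. *)
pose eps := e / (V + 1).
have eps0 : 0 < eps by rewrite divr_gt0// ltr_wpDl.
have bU : bmeas (fun x => f x ^+ 2 + eps * cst 1 x).
  by apply: bmeasD => //; exact/bmeasZ/bmeas_cst.
have Ub x : eps <= f x ^+ 2 + eps * cst 1 x <= M ^+ 2 + eps.
  rewrite mulr1 lerDr sqr_ge0/= lerD2r -real_normK ?num_real//.
  by rewrite ler_sqr ?nnegrE.
have [mU _] := bU.
have := dual_log_sobolev_box d0 dL rho0 Cf fL mU eps0 Ub; rewrite -/m.
set K := homdim A + _.
have -> : W delta L (fun x => f x ^+ 2 + eps * cst 1 x) = m + eps * V.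
  rewrite (wintD ww bf2); last exact/bmeasZ/bmeas_cst.
  by rewrite (wintZ _ ww)//; exact: bmeas_cst.
have bfU := bmeasM bf2 (bmeas_ln eps0 mU Ub).
have mN : 0 < m / N by rewrite divr_gt0.
have bA := bmeasZ (2 * ln (m / N) + 2) bf2.
have bB := bmeasZ (- (2 * (m / N))) babs.
have low : (2 * ln (m / N) + 2) * m - 2 * (m / N) * W delta L (fun x => `|f x|) <=
    W delta L (fun x => f x ^+ 2 * ln (f x ^+ 2 + eps * cst 1 x)).
  rewrite -mulNr -(wintZ _ ww bf2) -(wintZ _ ww babs) -(wintD ww bA bB).
  apply: (wint_le ww (bmeasD bA bB) bfU) => x; rewrite mulr1.
  have [->|fx0] := eqVneq (f x) 0.
    by rewrite expr0n/= normr0 !(mulr0, mul0r) addr0.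
  set y := `|f x|; have y0 : 0 < y by rewrite normr_gt0.
  have fy : f x ^+ 2 = y ^+ 2 by rewrite /y real_normK ?num_real.
  rewrite fy.
  have y20 : 0 < y ^+ 2 by rewrite exprn_gt0.
  have h1 : ln (y ^+ 2) <= ln (y ^+ 2 + eps).
    by rewrite ler_ln ?posrE ?addr_gt0// lerDl ltW.
  have h2 : 2 * y ^+ 2 * ln (m / N / y) <= 2 * y ^+ 2 * (m / N / y - 1).
    by rewrite ler_pM2l ?mulr_gt0// ln_leB1// divr_gt0.
  rewrite ln_div ?posrE// in h2.
  have h3 : 2 * y ^+ 2 * (m / N / y - 1) = 2 * (m / N) * y - 2 * y ^+ 2.
    by field; rewrite !gt_eqF.
  have h4 : y ^+ 2 * ln (y ^+ 2) <= y ^+ 2 * ln (y ^+ 2 + eps) by rewrite ler_pM2l.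
  rewrite lnXn// -mulr_natl in h4.
  rewrite h3 in h2; move: h2 h4; rewrite mulrBr; lra.
have low2 : 2 * (m / N) * W delta L (fun x => `|f x|) <= 2 * m.
  rewrite -mulrA ler_pM2l// mulrAC ler_pdivrMr// ler_pM2l//.
have lnm : m * ln (m + eps * V) <= m * ln m + e.
  have mV : 0 <= eps * V by rewrite mulr_ge0// ltW.
  have -> : m + eps * V = m * (1 + eps * V / m) by field; rewrite gt_eqF.
  have q0 : 0 <= eps * V / m by rewrite divr_ge0// ltW.
  rewrite lnM ?posrE ?ltr_pwDl// mulrDr lerD2l.
  apply: (@le_trans _ _ (m * (eps * V / m))).
    by rewrite ler_pM2l// le_ln1Dx// (lt_le_trans _ q0)// ltrN10.
  rewrite mulrCA divff ?gt_eqF// mulr1 /eps mulrAC ler_pdivrMr ?ltr_wpDl//.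
  by rewrite ler_pM2l// lerDl.
have WE2 : 2 / rho * W delta L (fun x => \sum_i df i x ^+ 2) <= 2 / rho * E.
  by rewrite ler_pM2l// divr_gt0.
move: low low2 lnm WE2; rewrite mulrDl => h1 h2 h3 h4 h5.
rewrite -[2 * m * _]mulrA [m * ln (m / N)]mulrC mulrA; lra.
Qed.

End nash.

(** * Nash inequality on the orthant *)

Section nash_orthant.
Context {R : realType}.
Notation mu := (@lebesgue_measure R).
Context (n : nat) (A : 'rV[R]_n) (hn : (1 <= n)%N) (hA : forall i, 0 <= A ord0 i).

Notation w delta L := (rV_weight (box_weight A delta L)).

Lemma monomial_ge0 x : 0 <= monomial A x.
Proof. by apply: prodr_ge0 => i _; exact: powR_ge0. Qed.

Lemma measurable_monomial : measurable_fun setT (monomial A).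
Proof.
apply: measurable_prod => i _.
exact: (measurableT_comp (measurable_absr_powR (A ord0 i)) (@measurable_coor R n i)).
Qed.

Lemma measurable_orthant : measurable (orthant A).
Proof.
have -> : orthant A = \bigcap_(i in [set i | 0 < A ord0 i])
     ((fun x : 'rV[R]_n => x ord0 i : measurableTypeR R) @^-1` `]0%R, +oo[%classic).
  apply/seteqP; split=> x /= h i Ai; first by rewrite /= in_itv/= andbT; exact: h.
  by have := h i Ai; rewrite /= in_itv/= andbT.
apply: fin_bigcap_measurable => // i _.
by rewrite -[X in measurable X]setTI; apply: measurable_coor.
Qed.

Lemma wintegral_mkcond h :
  wintegral A h = (\int[lebesgue_rV n]_x ((fun x => (h x * monomial A x)%:E) \_ (orthant A)) x)%E.
Proof. by rewrite /wintegral integral_mkcond. Qed.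

Definition in_box (delta L : R) (x : 'rV[R]_n) : bool :=
  [forall i, (if 0 < A ord0 i then delta else - L) <= x ord0 i <= L].

Lemma box_weightE delta L x : w delta L x = if in_box delta L x then monomial A x else 0.
Proof.
rewrite /rV_weight /monomial; case: ifPn => [/forallP xb|/forallPn[i xi]].
  apply: eq_bigr => i _; rewrite /box_weight /pow_weight patchE mem_set//=.
  by rewrite in_itv/= xb.
rewrite (bigD1 i)//= {1}/box_weight /pow_weight patchE memNset ?mul0r//=.
by rewrite in_itv/=; exact/negP.
Qed.

Lemma in_box_orthant delta L x : 0 < delta -> in_box delta L x -> orthant A x.
Proof.
by move=> d0 /forallP xb i Ai; have := xb i; rewrite Ai => /andP[+ _]; exact: lt_le_trans.
Qed.

Lemma wint_box_le delta L (h : 'rV[R]_n -> R) : 0 < delta -> bmeas h -> (forall x, 0 <= h x) ->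
  ((wint (lebesgue_rV n) (w delta L) h)%:E <= wintegral A h)%E.
Proof.
move=> d0 bh h0; have ww := weight_rV (fun i => @weight_box R n A hA delta L i d0).
have ih := wint_integrable ww bh; have [mh _] := bh; have [mw w0 _] := ww.
rewrite /wint /Rintegral fineK; last exact: integrable_fin_num.
rewrite wintegral_mkcond; apply: ge0_le_integral => //.
- by move=> x _; rewrite lee_fin; exact: mulr_ge0.
- by apply/measurable_EFinP; exact: measurable_funM.
- apply/(measurable_restrictT _ measurable_orthant).
  apply/measurable_EFinP/measurable_funTS; apply: measurable_funM => //.
  exact: measurable_monomial.
- move=> x _; rewrite patchE box_weightE; case: ifPn => [xb|_].
    by rewrite mem_set//; exact: in_box_orthant xb.
  rewrite mulr0; case: ifP => // _; rewrite lee_fin.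
  by apply: mulr_ge0 => //; exact: monomial_ge0.
Qed.

(** As the boxes grow, the truncated weights increase to x^A on the part of the
    orthant where h does not vanish. *)
Lemma wint_box_cvg L (h : 'rV[R]_n -> R) : 0 < L -> bmeas h -> (forall x, 0 <= h x) ->
  (forall x i, h x != 0 -> `|x ord0 i| < L) ->
  ((wint (lebesgue_rV n) (w (L / k.+2%:R) L) h)%:E @[k --> \oo] --> wintegral A h)%E.
Proof.
move=> L0 bh h0 hL; have [mh _] := bh.
have d0 k : 0 < L / k.+2%:R by rewrite divr_gt0.
have ww k := weight_rV (fun i => @weight_box R n A hA (L / k.+2%:R) L i (d0 k)).
pose g k x : \bar R := (h x * w (L / k.+2%:R) L x)%:E.
have -> : (fun k => (wint (lebesgue_rV n) (w (L / k.+2%:R) L) h)%:E) =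
    (fun k => \int[lebesgue_rV n]_x g k x)%E.
  apply/funext => k; rewrite /wint /Rintegral fineK//; apply: integrable_fin_num => //.
  exact: wint_integrable.
have glim x : g ^~ x @ \oo --> ((fun x => (h x * monomial A x)%:E) \_ (orthant A)) x.
  rewrite patchE; case: ifPn => [/[!inE] xA|/negP xA]; last first.
    have -> : g ^~ x = cst 0%:E.
      apply/funext => k; rewrite /g box_weightE; case: ifPn => [xb|]; last by rewrite mulr0.
      by exfalso; apply: xA; rewrite inE; exact: in_box_orthant xb.
    exact: cvg_cst.
  apply: cvg_near_cst.
  have [hx0|hx0] := eqVneq (h x) 0.
    by apply: nearW => k; rewrite /g hx0 !mul0r.
  have : \forall k \near \oo, forall i, 0 < A ord0 i -> L / k.+2%:R <= x ord0 i.
    apply: filter_forall => i.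
    have [Ai|Ai] := boolP (0 < A ord0 i); last by apply: nearW => k.
    have xi0 := xA i Ai.
    (* From this index on, the box contains x as far as its i-th coordinate is concerned. *)
    exists (Num.truncn (L / x ord0 i)) => // k /= hk _.
    rewrite ler_pdivrMr// mulrC -ler_pdivrMr// ltW//.
    apply: lt_le_trans (truncnS_gt _) _; rewrite ler_nat.
    by apply: ltnW; rewrite !ltnS.
  apply: filterS => k hk; rewrite /g box_weightE ifT//.
  apply/forallP => i; have := hL x i hx0; rewrite ltr_norml => /andP[h1 h2].
  by rewrite (ltW h2) andbT; case: ifP => [/hk//|_]; exact: ltW.
rewrite wintegral_mkcond.
have gk0 k x : (0 <= g k x)%E.
  by rewrite lee_fin; have [_ w0 _] := ww k; exact: mulr_ge0.
have mg k : measurable_fun setT (g k).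
  by apply/measurable_EFinP; have [mw _ _] := ww k; exact: measurable_funM.
have gnd x : nondecreasing_seq (g ^~ x).
  move=> i j ij; rewrite lee_fin ler_wpM2l// !box_weightE.
  case: ifPn => [/forallP xb|_]; last by case: ifP => // _; exact: monomial_ge0.
  rewrite ifT//; apply/forallP => l; have /andP[h1 h2] := xb l; rewrite h2 andbT.
  apply: le_trans h1; case: ifP => // _.
  by rewrite ler_pM2l// lef_pV2 ?posrE// ler_nat.
have := cvg_monotone_convergence (mu := lebesgue_rV n) measurableT mg
  (fun k x _ => gk0 k x) (fun x _ => gnd x).
suff -> : (\int[lebesgue_rV n]_x (fun x => limn (g ^~ x)) x)%E =
  (\int[lebesgue_rV n]_x ((fun x => (h x * monomial A x)%:E) \_ (orthant A)) x)%E by [].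
by apply: eq_integral => x _; apply/cvg_lim => //; exact: glim.
Qed.

(** Only upper bounds E and N of the energy and of the L^1 norm are assumed, and
    positive ones, so that no degenerate case has to be distinguished here. *)
Lemma nash_C1 (L E N : R) (f : 'rV[R]_n -> R) df :
  0 < L -> 0 < E -> 0 < N -> C1b f df ->
  (forall x i, f x != 0 -> `|x ord0 i| < L) ->
  (wintegral A (fun x => \sum_i df i x ^+ 2)%R <= E%:E)%E ->
  (wintegral A (fun x => `|f x|)%R <= N%:E)%E ->
  exists m : R, wintegral A (fun x => f x ^+ 2)%R = m%:E /\
    m `^ (1 + 2 / homdim A) <=
      2 / (PiA A * expR 1 * homdim A) * E * N `^ (4 / homdim A).
Proof.
move=> L0 E0 N0 Cf fL WE WN.
have [bf bdf] := C1b_bmeas Cf; have bf2 := bmeas_sqr bf.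
have [mf [M fM]] := bf.
have babs : bmeas (fun x => `|f x|).
  split; first exact: (measurableT_comp (@normr_measurable R setT) mf).
  by exists M => x; rewrite normr_id.
have bS : bmeas (fun x => \sum_i df i x ^+ 2).
  elim: (index_enum _) => [|i s IHs].
    by under eq_fun do rewrite big_nil; exact: bmeas_cst.
  by under eq_fun do rewrite big_cons; apply: bmeasD => //; exact/bmeas_sqr/bdf.
set D := homdim A; have D0 : 0 < D := homdim_gt0 hn hA; have P0 := PiA_gt0 hA.
have p0 : 0 < 1 + 2 / D by rewrite addr_gt0// divr_gt0.
set B := _ * N `^ _.
have B0 : 0 <= B.
  rewrite /B mulr_ge0 ?powR_ge0// mulr_ge0 ?(ltW E0)// divr_ge0// mulr_ge0 ?(ltW D0)//.
  by rewrite mulr_ge0 ?expR_ge0 ?(ltW P0).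
have B1 : (B `^ (1 + 2 / D)^-1) `^ (1 + 2 / D) = B.
  by rewrite -powRrM mulVf ?gt_eqF// powRr1.
have fL2 x i : f x ^+ 2 != 0 -> `|x ord0 i| < L.
  by rewrite sqrf_eq0; exact: fL.
have cvgm := wint_box_cvg L0 bf2 (fun x => sqr_ge0 _) fL2.
have d0 k : 0 < L / k.+2%:R by rewrite divr_gt0.
have dL k : L / k.+2%:R < L by rewrite ltr_pdivrMr// ltr_pMr// ltr1n.
have bound k : wint (lebesgue_rV n) (w (L / k.+2%:R) L) (fun x => f x ^+ 2) <=
    B `^ (1 + 2 / D)^-1.
  have ww := weight_rV (fun i => @weight_box R n A hA (L / k.+2%:R) L i (d0 k)).
  have [m0|m0] := leP (wint (lebesgue_rV n) (w (L / k.+2%:R) L) (fun x => f x ^+ 2)) 0.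
    exact: le_trans m0 (powR_ge0 _ _).
  have h1 : wint (lebesgue_rV n) (w (L / k.+2%:R) L) (fun x => \sum_i df i x ^+ 2) <= E.
    rewrite -lee_fin; apply: le_trans WE; apply: wint_box_le => // x.
    by apply: sumr_ge0 => i _; exact: sqr_ge0.
  have h2 : wint (lebesgue_rV n) (w (L / k.+2%:R) L) (fun x => `|f x|) <= N.
    by rewrite -lee_fin; apply: le_trans WN; apply: wint_box_le.
  have := nash_box hn hA (d0 k) (dL k) E0 N0 Cf fL h1 h2 m0; rewrite -/D -/B => h.
  rewrite leNgt; apply/negP => Bm.
  have := gt0_ltr_powR p0 (powR_ge0 _ _ : _ \is Num.nneg) (ltW m0 : _ \is Num.nneg) Bm.
  by rewrite B1 => /lt_le_trans/(_ h); rewrite ltxx.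
have leB : (wintegral A (fun x => (f x ^+ 2)%R) <= (B `^ (1 + 2 / D)^-1)%:E)%E.
  rewrite -(cvg_lim _ cvgm)//; apply: lime_le.
    by apply/cvg_ex; eexists; exact: cvgm.
  by apply: nearW => k; rewrite lee_fin.
have ge0 : (0 <= wintegral A (fun x => (f x ^+ 2)%R))%E.
  by apply: integral_ge0 => x _; rewrite lee_fin mulr_ge0 ?monomial_ge0 ?sqr_ge0.
exists (fine (wintegral A (fun x => (f x ^+ 2)%R))).
have fin : wintegral A (fun x => (f x ^+ 2)%R) \is a fin_num.
  by rewrite ge0_fin_numE//; exact: le_lt_trans leB (ltry _).
split; first by rewrite fineK.
rewrite -B1; apply: ge0_ler_powR; rewrite ?nnegrE ?(ltW p0) ?powR_ge0//.
  exact: fine_ge0.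
by rewrite -lee_fin fineK.
Qed.

End nash_orthant.

(** * Gaussian cutoffs *)

Section cutoff.
Context {R : realType} (n : nat).
Implicit Types (x : 'rV[R]_n) (f : 'rV[R]_n -> R).

Definition sqnorm x : R := \sum_i x ord0 i ^+ 2.

Lemma sqnorm_ge0 x : 0 <= sqnorm x.
Proof. by apply: sumr_ge0 => i _; exact: sqr_ge0. Qed.

Lemma continuous_sum_rV (I : finType) (h : I -> 'rV[R]_n -> R) :
  (forall i, continuous (h i)) -> continuous (fun x => \sum_i h i x).
Proof.
move=> ch; elim: (index_enum _) => [|i s IHs].
  by under eq_fun do rewrite big_nil; exact: cst_continuous.
under eq_fun do rewrite big_cons.
by move=> x; apply: continuousD; [exact: ch|exact: IHs].
Qed.

Lemma continuous_sqnorm : continuous sqnorm.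
Proof.
apply: continuous_sum_rV => i x; apply: continuous_sqr.
exact: coord_continuous.
Qed.

Definition gauss_cutoff (s : R) x : R := expR (- (s * sqnorm x)).

Lemma gauss_cutoff_gt0 s x : 0 < gauss_cutoff s x. Proof. exact: expR_gt0. Qed.

Lemma gauss_cutoff_le1 s x : 0 <= s -> gauss_cutoff s x <= 1.
Proof.
by move=> s0; rewrite -expR0 ler_expR oppr_le0 mulr_ge0// sqnorm_ge0.
Qed.

Lemma continuous_gauss_cutoff s : continuous (gauss_cutoff s).
Proof.
move=> x; apply: (@continuous_comp _ _ _ (fun x => - (s * sqnorm x)) expR).
  apply: continuousN; apply: continuousM; first exact: cst_continuous.
  exact: continuous_sqnorm.
exact: continuous_expR.
Qed.

(** On a line parallel to an axis [sqnorm] is a polynomial of degree 2, which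
    reduces the derivatives of the cutoff to one variable. *)
Lemma sqnorm_line x i h :
  sqnorm (h *: delta_mx ord0 i + x) = sqnorm x + 2 * h * x ord0 i + h ^+ 2.
Proof.
rewrite /sqnorm (bigD1 i)//= [in RHS](bigD1 i)//= !mxE !eqxx mulr1.
rewrite (eq_bigr (fun j => x ord0 j ^+ 2)); last first.
  by move=> j ji; rewrite !mxE (negbTE ji) andbF mulr0 add0r.
by ring.
Qed.

Lemma is_derive_add (u v : R -> R) (t du dv : R) : is_derive t (1 : R) u du ->
  is_derive t (1 : R) v dv -> is_derive t (1 : R) (fun y => u y + v y) (du + dv).
Proof. by move=> hu hv; exact: is_deriveD. Qed.

Lemma is_derive_gauss_cutoff s x i :
  is_derive x (delta_mx ord0 i) (gauss_cutoff s) (- (2 * s * x ord0 i) * gauss_cutoff s x).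
Proof.
pose u (t : R) := - (s * (sqnorm x + 2 * t * x ord0 i + t ^+ 2)).
have du : is_derive (0 : R) (1 : R) u (- (2 * s * x ord0 i)).
  have h1 := is_derive_id (0 : R) (1 : R).
  have h2 := is_derive_mul h1 h1.
  have h3 := is_derive_mul (is_derive_cst (2 * x ord0 i) (0 : R) (1 : R)) h1.
  have h4 := is_derive_add (is_derive_add (is_derive_cst (sqnorm x) (0 : R) (1 : R)) h3) h2.
  have h5 := is_derive_mul (is_derive_cst (- s) (0 : R) (1 : R)) h4.
  have -> : u = fun y => cst (- s) y * (cst (sqnorm x) y + cst (2 * x ord0 i) y * id y + id y * id y).
    by apply/funext => t; rewrite /u /=; ring.
  move: h5; set l := (X in is_derive _ _ _ X) => h5.
  have -> : - (2 * s * x ord0 i) = l by rewrite /l /=; ring.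
  exact: h5.
have hE := is_derive1_comp (is_derive_expR (u 0)) du.
have E0 : u 0 = - (s * sqnorm x) by rewrite /u mulr0 mul0r expr0n/= !addr0.
rewrite mulrC /gauss_cutoff -E0.
apply: is_derive_slice hE => h.
by rewrite /gauss_cutoff sqnorm_line /= /u /GRing.scale/= mulr1 addr0.
Qed.

Lemma continuous_compact_bounded f (K : set 'rV[R]_n) : compact K -> continuous f ->
  (forall x, ~ K x -> f x = 0) -> exists M, forall x, `|f x| <= M.
Proof.
move=> cK cf fK.
have cfK : compact (f @` K).
  by apply: continuous_compact => //; exact: continuous_subspaceT.
have /compact_bounded[M [_ HM]] := cfK.
exists (`|M + 1|) => x; have [Kx|Kx] := pselect (K x); last by rewrite fK// normr0.
apply: le_trans (ler_norm _); apply: (HM (M + 1)); first by rewrite ltrDl.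
by exists x.
Qed.

Lemma C1c_support (phi : 'rV[R]_n -> R) : C1c phi ->
  [/\ continuous phi, (forall i, continuous (fun x => gradient phi x ord0 i)) &
    exists K : set 'rV[R]_n, [/\ compact K, (forall x, ~ K x -> phi x = 0) &
      forall i x, ~ K x -> gradient phi x ord0 i = 0]].
Proof.
move=> [dphi cgrad cK]; set K := closure _ in cK.
have phiK x : ~ K x -> phi x = 0.
  by move=> Kx; apply/eqP; apply: contrapT => /negP px; apply: Kx; exact: subset_closure.
split.
- by move=> x; exact: differentiable_continuous.
- move=> i x; apply: (@continuous_comp _ _ _ (gradient phi) (fun v : 'rV[R]_n => v ord0 i)).
    exact: cgrad.
  exact: coord_continuous.
exists K; split => // i x Kx; rewrite mxE.
have nK : \forall y \near x, phi y = cst 0 y.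
  have oK : open (~` K) by apply: closed_openC; exact: closed_closure.
  by have := open_nbhs_nbhs (conj oK Kx); apply: filterS => y; exact: phiK.
by rewrite (near_eq_derive _ nK) derive_cst.
Qed.

Lemma C1c_cutoff (phi : 'rV[R]_n -> R) (s : R) : C1c phi ->
  C1b (fun x => phi x * gauss_cutoff s x)
    (fun i x => gradient phi x ord0 i * gauss_cutoff s x
                + phi x * (- (2 * s * x ord0 i) * gauss_cutoff s x)) /\
  exists2 L, 0 < L & forall x i, phi x * gauss_cutoff s x != 0 -> `|x ord0 i| < L.
Proof.
move=> C1phi; have [dphi _ _] := C1phi.
have [cphi cg [K [cK phiK gradK]]] := C1c_support C1phi.
have cchi : continuous (gauss_cutoff s) by exact: continuous_gauss_cutoff.
have cpsi : continuous (fun x => phi x * gauss_cutoff s x).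
  by move=> x; apply: continuousM; [exact: cphi|exact: cchi].
have cdx i x : {for x, continuous (fun x => gradient phi x ord0 i * gauss_cutoff s x
                + phi x * (- (2 * s * x ord0 i) * gauss_cutoff s x))}.
  apply: continuousD; apply: continuousM.
  - exact: cg.
  - exact: cchi.
  - exact: cphi.
  - apply: continuousM; last exact: cchi.
    apply: continuousN; apply: continuousM; first exact: cst_continuous.
    exact: coord_continuous.
have cd i : continuous (fun x => gradient phi x ord0 i * gauss_cutoff s x
                + phi x * (- (2 * s * x ord0 i) * gauss_cutoff s x)) by exact: cdx.
split.
  split => //.
    by apply: (continuous_compact_bounded cK cpsi) => x /phiK ->; rewrite mul0r.
  move=> i; split => //.
    move=> x; have dp : is_derive x (delta_mx ord0 i) phi (gradient phi x ord0 i).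
      by rewrite mxE; apply: DeriveDef => //; exact: diff_derivable.
    have := @is_deriveM _ _ _ _ _ _ _ _ dp (is_derive_gauss_cutoff s x i).
    have -> : phi x *: (- (2 * s * x ord0 i) * gauss_cutoff s x) +
      gauss_cutoff s x *: gradient phi x ord0 i = gradient phi x ord0 i * gauss_cutoff s x
                + phi x * (- (2 * s * x ord0 i) * gauss_cutoff s x).
      by rewrite /GRing.scale/= addrC; congr (_ + _); rewrite mulrC.
    by [].
  apply: (continuous_compact_bounded cK (cd i)) => x Kx.
  by rewrite phiK// gradK// !mul0r addr0.
have cqK : compact (sqnorm @` K).
  by apply: continuous_compact => //; exact/continuous_subspaceT/continuous_sqnorm.
have /compact_bounded[M [_ HM]] := cqK.
exists (`|M| + 2); first by rewrite ltr_wpDl.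
move=> x i; rewrite mulf_eq0 negb_or => /andP[px _].
have Kx : K x by apply: contrapT => /phiK phi0; rewrite phi0 eqxx in px.
have qx : `|sqnorm x| <= `|M| + 1.
  apply: (HM (`|M| + 1)); last by exists x.
  by rewrite (le_lt_trans (ler_norm _))// ltrDl.
rewrite ger0_norm ?sqnorm_ge0// in qx.
have xq : `|x ord0 i| ^+ 2 <= sqnorm x.
  rewrite real_normK ?num_real// /sqnorm (bigD1 i)//= lerDl.
  by apply: sumr_ge0 => j _; exact: sqr_ge0.
have t0 := normr_ge0 (x ord0 i); have M0 := normr_ge0 M.
move: xq qx t0 M0; set t := `|x ord0 i|; set MM := `|M|.
rewrite ltNge => h1 h2 h3 h4; apply/negP => h5; nra.
Qed.

End cutoff.

(** * Comparison of weighted integrals *)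

Section approximation.
Context {R : realType} (n : nat) (A : 'rV[R]_n) (hA : forall i, 0 <= A ord0 i).
Notation mu := (@lebesgue_measure R).
Implicit Types (h : 'rV[R]_n -> R).
Notation I := (wintegral A).
Notation msr h := (measurable_fun (orthant A) h).

Lemma msr_weighted h : msr h ->
  measurable_fun (orthant A) (fun x => (h x * monomial A x)%:E).
Proof.
move=> mh; apply/measurable_EFinP; apply: measurable_funM => //.
exact: (measurable_funTS (measurable_monomial A)).
Qed.

Lemma wintegral_le h1 h2 : msr h1 -> msr h2 -> (forall x, 0 <= h1 x) ->
  (forall x, orthant A x -> h1 x <= h2 x) -> (I h1 <= I h2)%E.
Proof.
move=> m1 m2 h10 h12.
apply: ge0_le_integral; first exact: measurable_orthant.
- by move=> x _; rewrite lee_fin mulr_ge0// monomial_ge0.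
- exact: msr_weighted.
- exact: msr_weighted.
- by move=> x xA; rewrite lee_fin ler_wpM2r ?monomial_ge0// h12.
Qed.

Lemma wintegral_le_comb h h1 h2 (a b al be : R) : msr h -> msr h1 -> msr h2 ->
  (forall x, 0 <= h x) -> (forall x, 0 <= h1 x) -> (forall x, 0 <= h2 x) ->
  0 <= a -> 0 <= b -> (forall x, orthant A x -> h x <= a * h1 x + b * h2 x) ->
  (I h1 <= al%:E)%E -> (I h2 <= be%:E)%E -> (I h <= (a * al + b * be)%:E)%E.
Proof.
move=> m0 m1 m2 h0 h10 h20 a0 b0 hle I1 I2.
have mO := measurable_orthant A.
have ma : msr (fun x => a * h1 x) by apply: measurable_funM.
have mb : msr (fun x => b * h2 x) by apply: measurable_funM.
have g0 (k : R) h' x : 0 <= k -> (forall x, 0 <= h' x) -> (0 <= (k * h' x * monomial A x)%:E)%E.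
  by move=> k0 h'0; rewrite lee_fin mulr_ge0 ?monomial_ge0// mulr_ge0.
apply: (@le_trans _ _ (I (fun x => a * h1 x + b * h2 x)%R)).
  by apply: wintegral_le => //; exact: measurable_funD.
have -> : (I (fun x => a * h1 x + b * h2 x)%R =
    I (fun x => a * h1 x)%R + I (fun x => b * h2 x)%R)%E.
  rewrite /wintegral -(ge0_integralD _ mO)//.
  - by apply: eq_integral => x _; rewrite mulrDl EFinD.
  - by move=> x _; exact: g0.
  - exact: msr_weighted.
  - by move=> x _; exact: g0.
  - exact: msr_weighted.
have IZ (k : R) h' : 0 <= k -> msr h' -> (forall x, 0 <= h' x) ->
    (I (fun x => k * h' x)%R = k%:E * I h')%E.
  move=> k0 m' h'0; rewrite /wintegral -ge0_integralZl//.
  - by apply: eq_integral => x _; rewrite -EFinM mulrA.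
  - exact: msr_weighted.
  - by move=> x _; rewrite lee_fin mulr_ge0 ?monomial_ge0.
rewrite (IZ a)// (IZ b)// EFinD !EFinM; apply: leeD; apply: lee_wpmul2l => //.
Qed.

Lemma wintegral_ge0 h : (forall x, 0 <= h x) -> (0 <= I h)%E.
Proof.
by move=> h0; apply: integral_ge0 => x _; rewrite lee_fin mulr_ge0 ?monomial_ge0.
Qed.

(** Turns an upper bound by a real number into an equality with one, as needed
    to leave the extended reals. *)
Lemma wintegral_real h (a : R) : (forall x, 0 <= h x) -> (I h <= a%:E)%E ->
  I h = (fine (I h))%:E.
Proof.
move=> h0 ha; rewrite fineK// ge0_fin_numE ?wintegral_ge0//.
exact: le_lt_trans ha (ltry _).
Qed.

(** The integrand is a product of one-dimensional Gaussian weights with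
    rho = 4 s. *)
Lemma gauss_cutoff_wint (s : R) : 0 < s ->
  exists2 K : R, 0 <= K & (I (fun x => gauss_cutoff s x ^+ 2)%R <= K%:E)%E.
Proof.
move=> s0; have s4 : 0 < 4 * s by rewrite mulr_gt0.
have wg i : weight mu (gauss_weight (A ord0 i) (4 * s)).
  split; [exact: measurable_gauss_weight|exact: gauss_weight_ge0|].
  exact: integrable_gauss_weight.
exists (\prod_i \int[mu]_t gauss_weight (A ord0 i) (4 * s) t).
  by apply: prodr_ge0 => i _; apply: Rintegral_ge0 => t _; exact: gauss_weight_ge0.
rewrite -(integral_rV_weight wg) /wintegral.
have E x : gauss_cutoff s x ^+ 2 * monomial A x =
    rV_weight (fun i => gauss_weight (A ord0 i) (4 * s)) x.
  rewrite /rV_weight /gauss_weight big_split/= mulrC; congr (_ * _).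
  rewrite -expR_sum /gauss_cutoff -expRM_natl; congr expR.
  rewrite sumrN mulrN; congr (- _).
  rewrite mulrA /sqnorm mulr_sumr; by apply: eq_bigr => i _; field.
under eq_integral do rewrite E.
apply: ge0_subset_integral => //.
- exact: measurable_orthant.
- by apply/measurable_EFinP; apply: measurable_rV_weight => i; have [] := wg i.
- by move=> x _; rewrite lee_fin; apply: prodr_ge0 => i _; exact: gauss_weight_ge0.
Qed.

(** The product of h and exp(2 |x|^2) is bounded, and exp(- 2 |x|^2) is
    integrable for the weight. *)
Lemma wintegral_compact_support h (K : set 'rV[R]_n) : compact K -> continuous h ->
  (forall x, 0 <= h x) -> (forall x, ~ K x -> h x = 0) ->
  exists c : R, (I h <= c%:E)%E.
Proof.
move=> cK ch h0 hK.
have cchi : continuous (gauss_cutoff (- 2 : R) : 'rV[R]_n -> R).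
  exact: continuous_gauss_cutoff.
have chh : continuous (fun x => h x * gauss_cutoff (- 2) x).
  by move=> x; apply: continuousM; [exact: ch|exact: cchi].
have [M hM] : exists M, forall x, `|h x * gauss_cutoff (- 2) x| <= M.
  by apply: (continuous_compact_bounded cK chh) => x /hK ->; rewrite mul0r.
have [k _ hk] := gauss_cutoff_wint ltr01.
have cchi1 : continuous (gauss_cutoff (1 : R) : 'rV[R]_n -> R).
  exact: continuous_gauss_cutoff.
have m1 : msr (fun x => gauss_cutoff (1 : R) x ^+ 2).
  by apply: measurable_funTS; apply: measurable_funX; exact: continuous_measurable_rV.
have mh : msr h by apply: measurable_funTS; exact: continuous_measurable_rV.
have M0 : 0 <= M := le_trans (normr_ge0 _) (hM 0).
(* A comparison with a single function, as a degenerate linear combination. *)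
exists (M * k + 0 * k).
apply: (wintegral_le_comb mh m1 m1) => //; try by move=> x; exact: sqr_ge0.
move=> x _; rewrite mul0r addr0.
have -> : gauss_cutoff 1 x ^+ 2 = (gauss_cutoff (- 2) x)^-1.
  rewrite /gauss_cutoff -expRN -expRM_natl; congr expR; ring.
rewrite ler_pdivlMr ?gauss_cutoff_gt0//.
exact: le_trans (ler_norm _) (hM x).
Qed.

End approximation.

(** * Approximation in the closure *)

Section closure.
Context {R : realType} (n : nat) (A : 'rV[R]_n) (hn : (1 <= n)%N)
  (hA : forall i, 0 <= A ord0 i).
Implicit Types (h : 'rV[R]_n -> R).
Notation I := (wintegral A).
Notation msr h := (measurable_fun (orthant A) h).

Lemma sqr_enorm (v : 'rV[R]_n) : enorm v ^+ 2 = \sum_i v ord0 i ^+ 2.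
Proof. by rewrite sqr_sqrtr//; apply: sumr_ge0 => i _; exact: sqr_ge0. Qed.

(** The free parameter t makes this replace Minkowski's inequality: the
    factor of x^2 can be made arbitrarily close to 1. *)
Lemma sqr_leD (t x y : R) : 0 < t ->
  (x + y) ^+ 2 <= (1 + t) * x ^+ 2 + (1 + t^-1) * y ^+ 2.
Proof.
move=> t0; have : 0 <= t * (x - t^-1 * y) ^+ 2 by rewrite mulr_ge0 ?sqr_ge0// ltW.
have -> : t * (x - t^-1 * y) ^+ 2 = t * x ^+ 2 - 2 * x * y + t^-1 * y ^+ 2.
  by field; rewrite gt_eqF.
rewrite sqrrD -mulr_natl; lra.
Qed.

Lemma msr_sum_sqr (h : 'I_n -> 'rV[R]_n -> R) : (forall i, msr (h i)) ->
  msr (fun x => \sum_i h i x ^+ 2).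
Proof. by move=> mh; apply: measurable_sum => i; exact: measurable_funX. Qed.

Context (f : 'rV[R]_n -> R) (g : 'rV[R]_n -> 'rV[R]_n) (hf : H10 A f g).

Lemma msr_f : msr f. Proof. by have [] := hf. Qed.

Lemma msr_g i : msr (fun x => g x ord0 i).
Proof.
have [_ mg _] := hf.
exact: (measurable_comp measurableT (@subsetT _ _) (@measurable_coor R n i) mg).
Qed.

Lemma H10_approx (eta : R) : 0 < eta -> exists phi : 'rV[R]_n -> R,
  [/\ C1c phi, (I (fun x => (phi x - f x) ^+ 2)%R <= eta%:E)%E &
    (I (fun x => \sum_i (gradient phi x ord0 i - g x ord0 i) ^+ 2)%R <= eta%:E)%E].
Proof.
move=> eta0; have [_ _ [phi [C1phi cvg0]]] := hf.
have v0 : (0 < (eta `^ 2^-1)%:E)%E by rewrite lte_fin powR_gt0.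
have [k _ hk] := cvg0 _ (open_ereal_lt' v0).
have {}hk : (H1norm A (fun x => phi k x - f x) (fun x => gradient (phi k) x - g x)
    < (eta `^ 2^-1)%:E :> \bar R)%O by exact: (hk k (leqnn k)).
exists (phi k); have C1k := C1phi k.
have [cphi cgr _] := C1c_support C1k.
have mphi : msr (phi k) by apply: measurable_funTS; exact: continuous_measurable_rV.
have mgr i : msr (fun x => gradient (phi k) x ord0 i).
  by apply: measurable_funTS; exact: continuous_measurable_rV.
have m1 : msr (fun x => (phi k x - f x) ^+ 2).
  by apply: measurable_funX; apply: measurable_funB => //; exact: msr_f.
have m2 : msr (fun x => \sum_i (gradient (phi k) x ord0 i - g x ord0 i) ^+ 2).
  by apply: msr_sum_sqr => i; apply: measurable_funB => //; exact: msr_g.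
have s0 x : 0 <= \sum_i (gradient (phi k) x ord0 i - g x ord0 i) ^+ 2.
  by apply: sumr_ge0 => i _; exact: sqr_ge0.
pose e := I (fun x => (phi k x - f x) ^+ 2 +
    \sum_i (gradient (phi k) x ord0 i - g x ord0 i) ^+ 2).
have eE : H1norm A (fun x => phi k x - f x) (fun x => gradient (phi k) x - g x) =
    (e `^ 2^-1)%E.
  rewrite /H1norm /e; congr (_ `^ _)%E; congr wintegral; apply/funext => x.
  rewrite real_normK ?num_real// sqr_enorm; congr (_ + _).
  by apply: eq_bigr => i _; rewrite !mxE.
have e0 : (0 <= e)%E.
  by apply: wintegral_ge0 => x; rewrite addr_ge0 ?sqr_ge0.
have ele : (e <= eta%:E)%E.
  rewrite leNgt; apply/negP => eta_e.
  rewrite eE -poweR_EFin in hk.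
  suff /le_lt_trans/(_ hk) : (eta%:E `^ 2^-1 <= e `^ 2^-1)%E by rewrite ltxx.
  apply: gt0_ler_poweR; rewrite ?in_itv/= ?leey ?andbT ?lee_fin ?(ltW eta0) ?(ltW eta_e)//.
split => //.
- apply: le_trans ele; apply: wintegral_le => //.
  + exact: measurable_funD.
  + by move=> x; exact: sqr_ge0.
  + by move=> x _; rewrite lerDl.
- apply: le_trans ele; apply: wintegral_le => //.
  + exact: measurable_funD.
  + by move=> x _; rewrite lerDr sqr_ge0.
Qed.

Lemma wintegral_f_finite : exists F : R, (I (fun x => f x ^+ 2)%R <= F%:E)%E.
Proof.
have [phi [C1phi h1 _]] := H10_approx ltr01.
have [cphi _ [K [cK phiK _]]] := C1c_support C1phi.
have cphi2 : continuous (fun x => phi x ^+ 2).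
  by move=> x; apply: continuous_sqr; exact: cphi.
have phiK2 x : ~ K x -> phi x ^+ 2 = 0 by move=> /phiK ->; rewrite expr0n.
have [c hc] := wintegral_compact_support hA cK cphi2 (fun x => sqr_ge0 _) phiK2.
have mphi : msr phi by apply: measurable_funTS; exact: continuous_measurable_rV.
exists (2 * c + 2 * 1); apply: (wintegral_le_comb _ _ _ _ _ _ _ _ _ hc h1) => //.
- by apply: measurable_funX; exact: msr_f.
- exact: measurable_funX.
- by apply: measurable_funX; apply: measurable_funB => //; exact: msr_f.
- by move=> x; exact: sqr_ge0.
- by move=> x; exact: sqr_ge0.
- by move=> x; exact: sqr_ge0.
- move=> x _; have := @sqr_leD 1 (phi x) (f x - phi x) ltr01.
  have -> : phi x + (f x - phi x) = f x by ring.
  rewrite invr1 -[(f x - phi x) ^+ 2]sqrrN opprB.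
  lra.
Qed.

Lemma wintegral_g_finite :
  exists G : R, (I (fun x => \sum_i g x ord0 i ^+ 2)%R <= G%:E)%E.
Proof.
have [phi [C1phi _ h1]] := H10_approx ltr01.
have [_ cgr [K [cK _ gradK]]] := C1c_support C1phi.
have cg2 : continuous (fun x => \sum_i gradient phi x ord0 i ^+ 2).
  by apply: continuous_sum_rV => i x; apply: continuous_sqr; exact: cgr.
have S0 (h' : 'I_n -> 'rV[R]_n -> R) x : 0 <= \sum_i h' i x ^+ 2.
  by apply: sumr_ge0 => i _; exact: sqr_ge0.
have gK x : ~ K x -> \sum_i gradient phi x ord0 i ^+ 2 = 0.
  by move=> Kx; rewrite big1// => i _; rewrite gradK// expr0n.
have [c hc] := wintegral_compact_support hA cK cg2 (S0 _) gK.
have mgr i : msr (fun x => gradient phi x ord0 i).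
  by apply: measurable_funTS; exact: continuous_measurable_rV.
exists (2 * c + 2 * 1); apply: (wintegral_le_comb _ _ _ _ _ _ _ _ _ hc h1) => //.
- by apply: msr_sum_sqr => i; exact: msr_g.
- exact: msr_sum_sqr.
- by apply: msr_sum_sqr => i; apply: measurable_funB => //; exact: msr_g.
- exact: (S0 (fun i x => g x ord0 i)).
- exact: (S0 (fun i x => gradient phi x ord0 i)).
- exact: (S0 (fun i x => gradient phi x ord0 i - g x ord0 i)).
- move=> x _; rewrite !mulr_sumr -big_split/=; apply: ler_sum => i _.
  have := @sqr_leD 1 (gradient phi x ord0 i) (g x ord0 i - gradient phi x ord0 i) ltr01.
  have -> : gradient phi x ord0 i + (g x ord0 i - gradient phi x ord0 i) = g x ord0 i.
    by ring.
  rewrite invr1 -[(g x ord0 i - gradient phi x ord0 i) ^+ 2]sqrrN opprB.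
  lra.
Qed.

End closure.

(** * Nash inequality for a cut-off function *)

Section cutoff_nash.
Context {R : realType} (n : nat) (A : 'rV[R]_n) (hn : (1 <= n)%N)
  (hA : forall i, 0 <= A ord0 i).
(** The left-hand side collects the errors in the energy of the cut-off
    approximation; e is the square of the distance to f. *)
Lemma energy_bound_arith (t e F G G' : R) : 0 < t -> t <= 1 -> 0 <= e -> e <= t ^+ 2 ->
  0 <= F -> 0 <= G -> t * (3 * G + 4 * F + 9) <= G' - G ->
  (1 + t) * ((1 + t) * G + (1 + t^-1) * e)
    + (1 + t^-1) * (2 * (t ^+ 2 / 2)) * (2 * F + 2 * e) <= G'.
Proof.
move=> t0 t1 e0 et F0 G0 tG.
have it0 : 0 <= 1 + t^-1 by rewrite addr_ge0// invr_ge0 ltW.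
have tt : t ^+ 2 <= t by rewrite expr2 ler_piMr// ltW.
have E : (1 + t^-1) * t ^+ 2 = t ^+ 2 + t by field; rewrite gt_eqF.
have h1 : (1 + t^-1) * e <= 2 * t.
  apply: le_trans (ler_wpM2l it0 et) _; rewrite E; lra.
have h2 : (1 + t^-1) * (2 * (t ^+ 2 / 2)) <= 2 * t.
  have -> : (1 + t^-1) * (2 * (t ^+ 2 / 2)) = t ^+ 2 + t by field; rewrite gt_eqF.
  lra.
have h3 : (1 + t^-1) * (2 * (t ^+ 2 / 2)) * (2 * F + 2 * e) <= 2 * t * (2 * F + 2).
  apply: ler_pM => //.
  - by rewrite mulr_ge0// mulr_ge0// divr_ge0// sqr_ge0.
  - by rewrite addr_ge0// mulr_ge0.
  - by rewrite lerD2l; lra.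
have h4 : (1 + t) * ((1 + t) * G + (1 + t^-1) * e) <= (1 + t) * ((1 + t) * G + 2 * t).
  by rewrite ler_wpM2l ?lerD2l// addr_ge0// ltW.
have h5 : t ^+ 2 * G <= t * G by rewrite ler_wpM2r.
apply: le_trans (lerD h4 h3) _; move: t0 tG tt h5; clear; lra.
Qed.

Context (f : 'rV[R]_n -> R) (g : 'rV[R]_n -> 'rV[R]_n) (hf : H10 A f g).
Notation I := (wintegral A).
Notation msr h := (measurable_fun (orthant A) h).
Notation D := (homdim A).
Notation p := (1 + 2 / D).
Notation nash_cst := (2 / (PiA A * expR 1 * D)).

(** This bounds the square of the gradient of the cutoff by 2 s, from
    u exp(- u) <= 1 with u = 2 s |x|^2. *)
Lemma sqr_cutoff_sqnorm (s : R) (x : 'rV[R]_n) : 0 < s ->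
  4 * s ^+ 2 * sqnorm x * gauss_cutoff s x ^+ 2 <= 2 * s.
Proof.
move=> s0; set u := 2 * s * sqnorm x.
have E : gauss_cutoff s x ^+ 2 = (expR u)^-1.
  by rewrite /gauss_cutoff -expRM_natl -expRN; congr expR; rewrite /u; ring.
have hu : u <= expR u by apply: le_trans (expR_ge1Dx u); rewrite lerDr ler01.
rewrite E ler_pdivrMr ?expR_gt0//.
have -> : 4 * s ^+ 2 * sqnorm x = 2 * s * u by rewrite /u; ring.
by rewrite ler_pM2l ?mulr_gt0.
Qed.

Lemma sum_sqr_dcutoff (s t : R) (phi : 'rV[R]_n -> R) (x : 'rV[R]_n) : 0 < s -> 0 < t ->
  \sum_i (gradient phi x ord0 i * gauss_cutoff s x
     + phi x * (- (2 * s * x ord0 i) * gauss_cutoff s x)) ^+ 2 <=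
  (1 + t) * (\sum_i gradient phi x ord0 i ^+ 2) + ((1 + t^-1) * (2 * s)) * phi x ^+ 2.
Proof.
move=> s0 t0; set c := gauss_cutoff s x.
have c0 : 0 <= c := ltW (gauss_cutoff_gt0 s x).
have c1 : c ^+ 2 <= 1 by rewrite expr_le1// gauss_cutoff_le1// ltW.
have it : 0 <= 1 + t^-1 by rewrite addr_ge0// invr_ge0 ltW.
apply: (@le_trans _ _ (\sum_i ((1 + t) * gradient phi x ord0 i ^+ 2 +
    ((1 + t^-1) * phi x ^+ 2 * (4 * s ^+ 2 * c ^+ 2)) * x ord0 i ^+ 2))).
  apply: ler_sum => i _; apply: le_trans (sqr_leD _ _ t0) _; apply: lerD.
    rewrite ler_wpM2l ?addr_ge0 ?(ltW t0)// exprMn.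
    by rewrite ler_piMr// sqr_ge0.
  rewrite le_eqVlt; apply/orP; left; apply/eqP; ring.
rewrite big_split/= -!mulr_sumr lerD2l.
have := sqr_cutoff_sqnorm x s0; rewrite -/c -/(sqnorm x) => h.
have h2 : 0 <= (1 + t^-1) * phi x ^+ 2 by rewrite mulr_ge0// sqr_ge0.
have := ler_wpM2l h2 h; lra.
Qed.

Lemma powR_le_inv (m B : R) : 0 <= m -> 0 <= B -> m `^ p <= B -> m <= B `^ p^-1.
Proof.
have p0 : 0 < p by rewrite addr_gt0// divr_gt0// homdim_gt0.
move=> m0 B0 mB.
have -> : m = (m `^ p) `^ p^-1 by rewrite -powRrM mulfV ?gt_eqF// powRr1.
by apply: ge0_ler_powR; rewrite ?nnegrE ?invr_ge0 ?powR_ge0 ?(ltW p0).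
Qed.

Lemma nash_cst_ge0 : 0 <= nash_cst.
Proof.
rewrite divr_ge0// mulr_ge0 ?(ltW (homdim_gt0 hn hA))//.
by rewrite mulr_ge0 ?expR_ge0// ltW// PiA_gt0.
Qed.

Context (F G N G' N' : R) (F0 : 0 <= F) (G0 : 0 <= G) (N0 : 0 <= N)
  (IF : (I (fun x => f x ^+ 2)%R <= F%:E)%E)
  (IG : (I (fun x => \sum_i g x ord0 i ^+ 2)%R <= G%:E)%E)
  (IN : (I (fun x => `|f x|)%R <= N%:E)%E)
  (GG' : G < G') (NN' : N < N').
Let B := (nash_cst * G' * N' `^ (4 / D)) `^ p^-1.

(** Let phi approximate f within eta in the H^1 norm, and let c be the cutoff.
    The function phi c is C^1 with bounded support, so the Nash inequality holds
    for it.  Its energy is at most that of f up to terms in theta, since the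
    gradient of c has norm at most theta; its L^1 norm is at most that of f plus
    int |phi - f| c, which the Cauchy-Schwarz inequality makes small because c
    is square integrable; and its L^2 norm is close to that of f c. *)
Lemma nash_cutoff (theta : R) : 0 < theta -> theta <= 1 ->
  theta * (3 * G + 4 * F + 9) <= G' - G -> 3 * theta <= N' - N ->
  (I (fun x => f x ^+ 2 * gauss_cutoff (theta ^+ 2 / 2) x ^+ 2)%R <=
   ((1 + theta) * B + 2 * theta)%:E)%E.
Proof.
move=> t0 t1 tG tN.
set s := theta ^+ 2 / 2.
have t20 : 0 < theta ^+ 2 by rewrite exprn_gt0.
have s0 : 0 < s by rewrite divr_gt0.
have [K K0 IK] := gauss_cutoff_wint hA s0.
(* With K the integral of the squared cutoff, the L^1 error eta + eta K is theta. *)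
pose eta := theta / (1 + K).
have K1 : 0 < 1 + K by rewrite ltr_pwDl.
have eta0 : 0 < eta by rewrite divr_gt0.
have etat : eta <= theta by rewrite ler_pdivrMr// ler_peMr ?(ltW t0)// lerDl.
have etaK : eta + eta * K = theta.
  by rewrite /eta -[X in X + _]mulr1 -mulrDr divfK// gt_eqF.
have eta20 : 0 < eta ^+ 2 by rewrite exprn_gt0.
have eta2 : eta ^+ 2 <= theta ^+ 2 by rewrite ler_sqr ?nnegrE ?(ltW eta0) ?(ltW t0).
have [phi [C1phi I1 I2]] := H10_approx hf eta20.
have [C1psi [L L0 psiL]] := C1c_cutoff s C1phi.
have [cphi cgr _] := C1c_support C1phi.
have cchi : continuous (gauss_cutoff s : 'rV[R]_n -> R).
  exact: continuous_gauss_cutoff.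
have mchi : msr (gauss_cutoff s).
  by apply: measurable_funTS; exact: continuous_measurable_rV.
have mphi : msr phi by apply: measurable_funTS; exact: continuous_measurable_rV.
have mgr i : msr (fun x => gradient phi x ord0 i).
  by apply: measurable_funTS; exact: continuous_measurable_rV.
have mf := msr_f hf; have mg := msr_g hf.
have mchi2 : msr (fun x => gauss_cutoff s x ^+ 2) by exact: measurable_funX.
have mphi2 : msr (fun x => phi x ^+ 2) by exact: measurable_funX.
have mf2 : msr (fun x => f x ^+ 2) by exact: measurable_funX.
have mpf : msr (fun x => (phi x - f x) ^+ 2).
  by apply: measurable_funX; exact: measurable_funB.
have mdg : msr (fun x => \sum_i (gradient phi x ord0 i - g x ord0 i) ^+ 2).
  by apply: msr_sum_sqr => i; exact: measurable_funB.
have mG : msr (fun x => \sum_i g x ord0 i ^+ 2) by exact: msr_sum_sqr.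
have mgrad : msr (fun x => \sum_i gradient phi x ord0 i ^+ 2) by exact: msr_sum_sqr.
have S0 (h' : 'I_n -> 'rV[R]_n -> R) x : 0 <= \sum_i h' i x ^+ 2.
  by apply: sumr_ge0 => i _; exact: sqr_ge0.
have [bpsi bdpsi] := C1b_bmeas C1psi.
have it0 : 0 <= 1 + theta^-1 by rewrite addr_ge0// invr_ge0 ltW.
have t10 : 0 <= 1 + theta by rewrite addr_ge0// ltW.
have Ea : (I (fun x => \sum_i gradient phi x ord0 i ^+ 2)%R <=
    ((1 + theta) * G + (1 + theta^-1) * eta ^+ 2)%:E)%E.
  apply: (wintegral_le_comb mgrad mG mdg (S0 _)
    (S0 (fun i x => g x ord0 i)) (S0 (fun i x => gradient phi x ord0 i - g x ord0 i))
    t10 it0 _ IG I2) => x _.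
  rewrite !mulr_sumr -big_split/=; apply: ler_sum => i _.
  have := sqr_leD (g x ord0 i) (gradient phi x ord0 i - g x ord0 i) t0.
  by rewrite [X in X ^+ 2 <= _]addrC subrK.
have Eb : (I (fun x => phi x ^+ 2)%R <= (2 * F + 2 * eta ^+ 2)%:E)%E.
  apply: (wintegral_le_comb mphi2 mf2 mpf _ _ _ _ _ _ IF I1) => //;
    try by move=> x; exact: sqr_ge0.
  move=> x _; have := sqr_leD (f x) (phi x - f x) (@ltr01 R).
  by rewrite [X in X ^+ 2 <= _]addrC subrK invr1.
have WE : (I (fun x => \sum_i (gradient phi x ord0 i * gauss_cutoff s x
     + phi x * (- (2 * s * x ord0 i) * gauss_cutoff s x)) ^+ 2)%R <= G'%:E)%E.
  have s2 : 0 <= (1 + theta^-1) * (2 * s) by rewrite mulr_ge0// mulr_ge0// ltW.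
  have msum : msr (fun x => \sum_i (gradient phi x ord0 i * gauss_cutoff s x
     + phi x * (- (2 * s * x ord0 i) * gauss_cutoff s x)) ^+ 2).
    by apply: msr_sum_sqr => i; apply: measurable_funTS; have [] := bdpsi i.
  have := wintegral_le_comb msum mgrad mphi2 _ _ _ t10 s2
    (fun x _ => sum_sqr_dcutoff phi x s0 t0) Ea Eb.
  move=> h; apply: le_trans (h _ _ _) _.
  - exact: (S0 (fun i x => gradient phi x ord0 i * gauss_cutoff s x
     + phi x * (- (2 * s * x ord0 i) * gauss_cutoff s x))).
  - exact: (S0 (fun i x => gradient phi x ord0 i)).
  - by move=> x; exact: sqr_ge0.
  by rewrite lee_fin; exact: energy_bound_arith (ltW eta20) eta2 _ _ _.
have c01 (x : 'rV[R]_n) : 0 <= gauss_cutoff s x <= 1.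
  by rewrite (ltW (gauss_cutoff_gt0 s x)) gauss_cutoff_le1// ltW.
(* Young's inequality: |phi - f| c is at most h'. *)
pose h' x := eta^-1 * (phi x - f x) ^+ 2 + eta * gauss_cutoff s x ^+ 2.
have ie0 : 0 <= eta^-1 by rewrite invr_ge0 ltW.
have h'0 x : 0 <= h' x by rewrite addr_ge0// mulr_ge0 ?sqr_ge0// ltW.
have mh' : msr h' by apply: measurable_funD; apply: measurable_funM.
have Ih' : (I h' <= theta%:E)%E.
  have := @wintegral_le_comb _ _ A h' _ _ eta^-1 eta _ _ mh' mpf mchi2 h'0
    (fun x => sqr_ge0 _) (fun x => sqr_ge0 _) ie0 (ltW eta0) (fun x _ => lexx _) I1 IK.
  by rewrite expr2 mulKf ?gt_eqF// etaK.
have mpsi : msr (fun x => `|phi x * gauss_cutoff s x|).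
  by apply: measurableT_comp => //; exact: measurable_funM.
have mabs : msr (fun x => `|f x|) by exact: measurableT_comp.
have WN : (I (fun x => `|phi x * gauss_cutoff s x|)%R <= N'%:E)%E.
  have := @wintegral_le_comb _ _ A (fun x => `|phi x * gauss_cutoff s x|)
    (fun x => `|f x|) h' 1 1 _ _ mpsi mabs mh' (fun x => normr_ge0 _) (fun x => normr_ge0 _)
    h'0 ler01 ler01 _ IN Ih' => h; apply: le_trans (h _) _; last first.
    by rewrite lee_fin !mul1r; lra.
  move=> x _; rewrite !mul1r normrM; have /andP[c0 c1] := c01 x.
  rewrite (ger0_norm c0); set c := gauss_cutoff s x in c0 c1 *.
  have tri : `|phi x| <= `|f x| + `|phi x - f x|.
    by have := ler_normD (f x) (phi x - f x); rewrite [X in `|X| <= _]addrC subrK.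
  have h1 : `|phi x| * c <= (`|f x| + `|phi x - f x|) * c by exact: ler_wpM2r.
  have h2 : `|f x| * c <= `|f x| by rewrite ler_piMr.
  rewrite /h' -/c -[(phi x - f x) ^+ 2]real_normK ?num_real//.
  set y := `|phi x - f x| in h1 *.
  have h3 : 0 <= eta^-1 * (y - eta * c) ^+ 2 by rewrite mulr_ge0 ?sqr_ge0.
  have e3 : eta^-1 * (y - eta * c) ^+ 2 = eta^-1 * y ^+ 2 - 2 * (y * c) + eta * c ^+ 2.
    by field; rewrite gt_eqF.
  have y0 : 0 <= y * c by rewrite mulr_ge0 ?normr_ge0.
  rewrite e3 in h3; rewrite mulrDl in h1; lra.
have G'0 : 0 < G' by exact: le_lt_trans GG'.
have N'0 : 0 < N' by exact: le_lt_trans NN'.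
have [m [Im mle]] := nash_C1 hn hA L0 G'0 N'0 C1psi psiL WE WN.
have psi20 (x : 'rV[R]_n) : 0 <= (phi x * gauss_cutoff s x) ^+ 2 by exact: sqr_ge0.
have m0 : 0 <= m by rewrite -lee_fin -Im; exact: wintegral_ge0.
have mB : m <= B.
  apply: powR_le_inv => //.
  by rewrite mulr_ge0 ?powR_ge0// mulr_ge0 ?nash_cst_ge0 ?(ltW G'0).
have B0 : 0 <= B by exact: powR_ge0.
have mpsi2 : msr (fun x => (phi x * gauss_cutoff s x) ^+ 2).
  by apply: measurable_funX; exact: measurable_funM.
have mfc : msr (fun x => f x ^+ 2 * gauss_cutoff s x ^+ 2) by exact: measurable_funM.
have e10 : 0 <= 1 + eta by rewrite addr_ge0// ltW.
have ie10 : 0 <= 1 + eta^-1 by rewrite addr_ge0.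
have Im' : (I (fun x => (phi x * gauss_cutoff s x) ^+ 2)%R <= m%:E)%E by rewrite Im.
apply: le_trans (wintegral_le_comb mfc mpsi2 mpf _ psi20 _ e10 ie10 _ Im' I1) _.
- by move=> x; rewrite mulr_ge0 ?sqr_ge0.
- by move=> x; exact: sqr_ge0.
- move=> x _; have /andP[c0 c1] := c01 x; set c := gauss_cutoff s x in c0 c1 *.
  have := sqr_leD (phi x * c) ((f x - phi x) * c) eta0.
  have -> : phi x * c + (f x - phi x) * c = f x * c by ring.
  rewrite exprMn => /le_trans; apply; rewrite lerD2l ler_wpM2l// exprMn.
  by rewrite -[(f x - _) ^+ 2]sqrrN opprB ler_piMr ?sqr_ge0// expr_le1.
rewrite lee_fin.
have -> : (1 + eta^-1) * eta ^+ 2 = eta ^+ 2 + eta by field; rewrite gt_eqF.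
have h1 : (1 + eta) * m <= (1 + theta) * B by rewrite ler_pM// lerD2l.
have h2 : theta ^+ 2 <= theta by rewrite expr2 ler_piMr// ltW.
lra.
Qed.

End cutoff_nash.

(** * Removing the cutoff *)

Section limit.
Context {R : realType} (n : nat) (A : 'rV[R]_n) (hn : (1 <= n)%N)
  (hA : forall i, 0 <= A ord0 i).
Notation I := (wintegral A).
Notation msr h := (measurable_fun (orthant A) h).
Notation D := (homdim A).
Notation p := (1 + 2 / D).
Notation nash_cst := (2 / (PiA A * expR 1 * D)).

Lemma wintegral_cutoff_cvg (h : 'rV[R]_n -> R) (s : R^nat) : msr h -> (forall x, 0 <= h x) ->
  (forall k, 0 <= s k) -> nonincreasing_seq s -> s k @[k --> \oo] --> (0 : R) ->
  (I (fun x => h x * gauss_cutoff (s k) x ^+ 2)%R @[k --> \oo] --> I h)%E.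
Proof.
move=> mh h0 s0 sni scvg.
pose u k x : \bar R := (h x * gauss_cutoff (s k) x ^+ 2 * monomial A x)%:E.
have cchi k : continuous (gauss_cutoff (s k) : 'rV[R]_n -> R).
  exact: continuous_gauss_cutoff.
have mu' k : measurable_fun (orthant A) (u k).
  apply: msr_weighted; apply: measurable_funM => //.
  by apply: measurable_funTS; apply: measurable_funX; exact: continuous_measurable_rV.
have u0 k x : orthant A x -> (0 <= u k x)%E.
  by move=> _; rewrite lee_fin mulr_ge0 ?monomial_ge0// mulr_ge0// sqr_ge0.
have und x : orthant A x -> nondecreasing_seq (u ^~ x).
  move=> _ i j ij; rewrite lee_fin ler_wpM2r ?monomial_ge0// ler_wpM2l//.
  rewrite ler_sqr ?nnegrE ?(ltW (gauss_cutoff_gt0 _ _))//.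
  by rewrite ler_expR lerN2 ler_wpM2r ?sqnorm_ge0//; exact: sni.
have ulim x : u ^~ x @ \oo --> (h x * monomial A x)%:E.
  apply: cvg_EFin; first exact: nearW.
  have -> : h x * monomial A x = h x * (expR (- (0 * sqnorm x)) ^+ 2) * monomial A x.
    by rewrite mul0r oppr0 expR0 expr1n mulr1.
  apply: cvgMl; apply: cvgMr.
  rewrite expr2; under eq_fun do rewrite /= /gauss_cutoff expr2.
  have c1 : expR (- (s k * sqnorm x)) @[k --> \oo] --> expR (- (0 * sqnorm x)).
    by apply: continuous_cvg; [exact: continuous_expR|apply: cvgN; apply: cvgMl].
  exact: cvgM.
have := @cvg_monotone_convergence _ _ _ (lebesgue_rV n) _ (measurable_orthant A) u mu' u0 und.
suff -> : (\int[lebesgue_rV n]_(x in orthant A) (fun x => limn (u ^~ x)) x)%E = I h by [].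
by apply: eq_integral => x _; apply/cvg_lim => //; exact: ulim.
Qed.

Context (f : 'rV[R]_n -> R) (g : 'rV[R]_n -> 'rV[R]_n) (hf : H10 A f g).

(** The room between G and G' and between N and N' absorbs all errors once
    theta is small; then theta tends to 0 in the remaining estimate. *)
Lemma nash_closure_slack (F G N G' N' : R) : 0 <= F -> 0 <= G -> 0 <= N ->
  I (fun x => f x ^+ 2)%R = F%:E ->
  (I (fun x => \sum_i g x ord0 i ^+ 2)%R <= G%:E)%E ->
  (I (fun x => `|f x|)%R <= N%:E)%E -> G < G' -> N < N' ->
  F `^ p <= nash_cst * G' * N' `^ (4 / D).
Proof.
move=> F0 G0 N0 IF IG IN GG' NN'.
set C := nash_cst * G' * N' `^ (4 / D).
have p0 : 0 < p by rewrite addr_gt0// divr_gt0// homdim_gt0.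
have C0 : 0 <= C.
  rewrite mulr_ge0 ?powR_ge0// mulr_ge0 ?nash_cst_ge0//.
  exact: ltW (le_lt_trans G0 GG').
set B := C `^ p^-1.
have B0 : 0 <= B by exact: powR_ge0.
have IF' : (I (fun x => f x ^+ 2)%R <= F%:E)%E by rewrite IF.
have FB (t : R) : 0 < t -> t <= 1 -> t * (3 * G + 4 * F + 9) <= G' - G ->
    3 * t <= N' - N -> F <= (1 + t) * B + 2 * t.
  move=> t0 t1 tG tN.
  pose th (k : nat) : R := t / k.+1%:R.
  have th0 k : 0 < th k by rewrite divr_gt0.
  have tht k : th k <= t by rewrite ler_pdivrMr// ler_peMr ?(ltW t0)// ler1n.
  have thni : nonincreasing_seq th.
    by move=> i j ij; rewrite ler_pM2l// lef_pV2 ?posrE// ler_nat.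
  have thcvg : th k @[k --> \oo] --> (0 : R).
    rewrite -[X in _ --> X](mulr0 t); apply: cvgMr; exact: cvg_harmonic.
  pose s k := th k ^+ 2 / 2.
  have cv : (I (fun x => f x ^+ 2 * gauss_cutoff (s k) x ^+ 2)%R @[k --> \oo] -->
      I (fun x => f x ^+ 2)%R)%E.
    apply: wintegral_cutoff_cvg.
    - by apply: measurable_funX; exact: msr_f hf.
    - by move=> x; exact: sqr_ge0.
    - by move=> k; rewrite divr_ge0// sqr_ge0.
    - move=> i j ij; rewrite ler_pM2r ?invr_gt0// ler_sqr ?nnegrE ?(ltW (th0 _))//.
      exact: thni.
    - rewrite -[X in _ --> X](mul0r (2^-1 : R)); apply: cvgMl.
      rewrite -[X in _ --> X](mulr0 (0 : R)).
      under eq_fun do rewrite expr2; exact: cvgM.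
  rewrite -lee_fin -IF -(cvg_lim _ cv)//; apply: lime_le.
    by apply/cvg_ex; eexists; exact: cv.
  apply: nearW => k.
  have thk := tht k; have thk0 := th0 k.
  apply: le_trans (nash_cutoff hn hA hf F0 G0 N0 IF' IG IN GG' NN' (th0 k) _ _ _) _.
  - exact: le_trans thk t1.
  - apply: le_trans tG; rewrite ler_wpM2r//.
    by rewrite addr_ge0// addr_ge0// mulr_ge0.
  - by apply: le_trans tN; rewrite ler_pM2l.
  by rewrite lee_fin lerD// ?ler_pM2l// ler_wpM2r// lerD2l.
have FleB : F <= B.
  apply/ler_addgt0Pr => e e0.
  have Q0 : 0 < 3 * G + 4 * F + 9 by rewrite ltr_wpDl// addr_ge0// mulr_ge0.
  pose t := Num.min (Num.min 1 ((G' - G) / (3 * G + 4 * F + 9)))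
                    (Num.min ((N' - N) / 3) (e / (B + 2))).
  have B2 : 0 < B + 2 by rewrite ltr_wpDl.
  have t0 : 0 < t.
    by rewrite !lt_min ltr01 !divr_gt0 ?subr_gt0.
  have [t1 [t2 [t3 t4]]] : t <= 1 /\ t <= (G' - G) / (3 * G + 4 * F + 9) /\
      t <= (N' - N) / 3 /\ t <= e / (B + 2).
    have : t <= t by []; rewrite {2}/t !le_min => /andP[/andP[? ?] /andP[? ?]].
    by [].
  apply: le_trans (FB t t0 t1 _ _) _.
  - by rewrite -ler_pdivlMr.
  - by rewrite mulrC -ler_pdivlMr.
  - move: t4; rewrite ler_pdivlMr// => t4; rewrite mulrDl mul1r -addrA lerD2l.
    by rewrite [2 * t]mulrC -mulrDr.
have : F `^ p <= B `^ p by apply: ge0_ler_powR; rewrite ?nnegrE ?(ltW p0).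
by rewrite /B -powRrM mulVf ?gt_eqF// powRr1.
Qed.

(** N' is chosen so that its power is N^(4/D) + e, which avoids the
    continuity of powers at N = 0. *)
Lemma nash_closure (F G N : R) : 0 <= F -> 0 <= G -> 0 <= N ->
  I (fun x => f x ^+ 2)%R = F%:E ->
  (I (fun x => \sum_i g x ord0 i ^+ 2)%R <= G%:E)%E ->
  (I (fun x => `|f x|)%R <= N%:E)%E ->
  F `^ p <= nash_cst * G * N `^ (4 / D).
Proof.
move=> F0 G0 N0 IF IG IN; have D0 : 0 < D := homdim_gt0 hn hA.
have q0 : 0 < 4 / D by rewrite divr_gt0.
set C := nash_cst; have C0 : 0 <= C := nash_cst_ge0 hn hA.
set Y := N `^ (4 / D); have Y0 : 0 <= Y by exact: powR_ge0.
have step (e : R) : 0 < e -> F `^ p <= C * (G + e) * (Y + e).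
  move=> e0; pose N' := (Y + e) `^ (4 / D)^-1.
  have Ye : 0 < Y + e by rewrite ltr_wpDl.
  have NE : N = Y `^ (4 / D)^-1 by rewrite -powRrM mulfV ?gt_eqF// powRr1.
  have NN' : N < N'.
    by rewrite NE; apply: gt0_ltr_powR; rewrite ?invr_gt0 ?nnegrE ?ltrDl// ltW.
  have -> : Y + e = N' `^ (4 / D) by rewrite -powRrM mulVf ?gt_eqF// powRr1// ltW.
  by apply: nash_closure_slack IF IG IN _ NN' => //; rewrite ltrDl.
apply/ler_addgt0Pr => d d0.
pose Q := C * (G + Y + 1) + 1.
have Q0 : 0 < Q by rewrite ltr_wpDl// mulr_ge0// addr_ge0// addr_ge0.
pose e := Num.min 1 (d / Q).
have e0 : 0 < e by rewrite lt_min ltr01 divr_gt0.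
have [e1 eQ] : e <= 1 /\ e <= d / Q.
  by have : e <= e by []; rewrite {2}/e le_min => /andP[].
apply: le_trans (step e e0) _.
have h1 : C * (e * e) <= C * e.
  by rewrite ler_wpM2l// ler_piMr// ltW.
rewrite ler_pdivlMr// /Q in eQ; move: eQ h1 e0; rewrite mulrDr mulr1.
have -> : C * (G + e) * (Y + e) = C * G * Y + C * (G * e) + C * (Y * e) + C * (e * e) by ring.
have -> : e * (C * (G + Y + 1)) = C * (G * e) + C * (Y * e) + C * e by ring.
lra.
Qed.

End limit.

Theorem corollary1p4 (R : realType) (n : nat) (hn : (1 <= n)%N)
    (A : 'rV[R]_n) (hA : forall i, 0 <= A ord0 i)
    (f : 'rV[R]_n -> R) (gradf : 'rV[R]_n -> 'rV[R]_n)
    (hf : H10 A f gradf) (hf1 : wintegrable A f) :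
  (wintegral A (fun x => (`|f x| ^+ 2)%R) `^ (1 + 2 / homdim A)
   <= (2 / (PiA A * expR 1 * homdim A))%:E
      * wintegral A (fun x => (enorm (gradf x) ^+ 2)%R)
      * wintegral A (fun x => `|f x|%R) `^ (4 / homdim A))%E.
Proof.
have -> : (fun x => `|f x| ^+ 2)%R = (fun x => f x ^+ 2).
  by apply/funext => x; rewrite real_normK ?num_real.
have -> : (fun x => enorm (gradf x) ^+ 2)%R = (fun x => \sum_i gradf x ord0 i ^+ 2).
  by apply/funext => x; rewrite sqr_enorm.
have f20 (x : 'rV[R]_n) : 0 <= f x ^+ 2 by exact: sqr_ge0.
have g20 (x : 'rV[R]_n) : 0 <= \sum_i gradf x ord0 i ^+ 2.
  by apply: sumr_ge0 => i _; exact: sqr_ge0.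
have af0 (x : 'rV[R]_n) : 0 <= `|f x| by [].
have [F hF] := wintegral_f_finite hA hf.
have [G hG] := wintegral_g_finite hA hf.
have FE := wintegral_real f20 hF; have GE := wintegral_real g20 hG.
have Nfin : (wintegral A (fun x => `|f x|)%R < +oo)%E.
  have /integrableP[_] := hf1; congr (_ < _)%E; apply: eq_integral => x _ /=.
  by rewrite normrM [X in _ * X]ger0_norm// monomial_ge0.
have NE : (wintegral A (fun x => `|f x|)%R = (fine (wintegral A (fun x => `|f x|)%R))%:E)%E.
  by rewrite fineK// ge0_fin_numE// wintegral_ge0.
have F0 := fine_ge0 (wintegral_ge0 A f20).
have G0 := fine_ge0 (wintegral_ge0 A g20).
have N0 := fine_ge0 (wintegral_ge0 A af0).
rewrite FE GE NE !poweR_EFin -!EFinM lee_fin.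
apply: (nash_closure hn hA hf F0 G0 N0 FE).
- by rewrite -GE.
- by rewrite -NE.
Qed.
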